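(* For every integer $n\ge 5$, up to isomorphism, \[\operatorname{obs}(C_n)=C(n-2)\cup LF(n-1)\cup O(n-1),\] where for a positive integer $k$: $C(k)=\{C_m: m=3\text{ or }5\le m\le k+1\}$; $O(k)=\varnothing$ if $k\le 4$, $O(5)=\{B\}$, $O(6)=\{A,B\}$, and $O(k)=\{A,B,E\}$ if $k\ge 7$; $LF(k)=LF_1(k)\cup LF_2(k)\cup LF_3(k)$ with (all $m_2,m_4,m_6$ ranging over non-negative integers) $LF_1(k)=\{m_2K_2: 3m_2=k+2\}$, $LF_2(k)=\{K_1+m_2K_2+m_4P_4: 3m_2+5m_4=k+1\}$, $LF_3(k)=\{K_1+m_2K_2+m_4P_4+m_6P_6: 3m_2+5m_4+7m_6=k\}$.
   Context: All graphs are finite, simple and loopless. $P_n$ and $C_n$ denote the path and cycle on $n$ vertices; $K_1$, $K_2$ are the complete graphs on one and two vertices; $+$ denotes disjoint union and $mG$ the disjoint union of $m$ copies of $G$. A full-homomorphism $\varphi\colon G\to H$ is a map $V(G)\to V(H)$ such that for all $x,y\in V(G)$, $xy\in E(G)$ if and only if $\varphi(x)\varphi(y)\in E(H)$. A full $H$-colouring of $G$ is a full-homomorphism $G\to H$. A minimal $H$-obstruction is a graph $G$ that admits no full $H$-colouring while every proper induced subgraph of $G$ admits one; $\operatorname{obs}(H)$ denotes the set of minimal $H$-obstructions (up to isomorphism). The graphs $A$, $B$, $E$ have vertex set $\{v_0,\dots,v_5\}$ and edge sets: $E(A)=\{v_0v_1,v_1v_2,v_2v_3,v_3v_4,v_4v_5,v_1v_4\}$;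 $E(B)=E(A)\cup\{v_0v_5\}$; $E(E)=\{v_0v_1,v_1v_2,v_0v_5,v_1v_4,v_2v_3\}$. *)

(* Defs.v *)
(* Finite simple graphs are represented as a symmetric,
   irreflexive boolean relation [e : rel T] on a finite type [T]. *)
From mathcomp Require Import all_boot.
Set Implicit Arguments.
Unset Strict Implicit.
Unset Printing Implicit Defensive.

Definition full_hom_on (T U : finType) (e : rel T) (h : rel U) (S : {set T})
    (f : T -> U) : Prop :=
  forall x y, x \in S -> y \in S -> e x y = h (f x) (f y).

Definition full_colourable_on (T U : finType) (e : rel T) (h : rel U)
    (S : {set T}) : Prop :=
  exists f : T -> U, full_hom_on e h S f.

Definition minimal_obstruction (T U : finType) (e : rel T) (h : rel U) : Prop :=
  ~ full_colourable_on e h [set: T] /\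
  forall S : {set T}, S \proper [set: T] -> full_colourable_on e h S.

Definition graph_iso (T T' : finType) (e : rel T) (e' : rel T') : Prop :=
  exists f : T -> T', bijective f /\ forall x y, e x y = e' (f x) (f y).

(* The cycle C_m on vertex set {0,...,m-1} (meaningful for m >= 3). *)
Definition cycle_rel (m : nat) : rel 'I_m :=
  fun i j => (val j == (val i).+1 %% m) || (val i == (val j).+1 %% m).

Arguments cycle_rel m : clear implicits.

(* Disjoint union of paths P_{s_0} + P_{s_1} + ...; P_1 = K_1, P_2 = K_2. *)
Definition pf_vert (s : seq nat) : finType :=
  {i : 'I_(size s) & 'I_(nth 0 s i)}.

Definition pf_rel (s : seq nat) : rel (pf_vert s) :=
  fun u v => (tag u == tag v) &&
    (((tagged u).+1 == tagged v :> nat) || ((tagged v).+1 == tagged u :> nat)).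

Arguments pf_rel s : clear implicits.

Definition edges_rel (l : seq (nat * nat)) : rel 'I_6 :=
  fun i j => ((val i, val j) \in l) || ((val j, val i) \in l).

Definition graph_A : rel 'I_6 :=
  edges_rel [:: (0,1); (1,2); (2,3); (3,4); (4,5); (1,4)].
Definition graph_B : rel 'I_6 :=
  edges_rel [:: (0,1); (1,2); (2,3); (3,4); (4,5); (1,4); (0,5)].
Definition graph_E : rel 'I_6 :=
  edges_rel [:: (0,1); (1,2); (0,5); (1,4); (2,3)].

Definition obs_cycle_family (n : nat) (T : finType) (e : rel T) : Prop :=
  (exists m : nat, ((m == 3) || (5 <= m <= n - 1)) /\ graph_iso e (cycle_rel m)) \/
  (exists m2, 3 * m2 = n + 1 /\ graph_iso e (pf_rel (nseq m2 2))) \/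
  (exists m2 m4, 3 * m2 + 5 * m4 = n /\
     graph_iso e (pf_rel (1 :: nseq m2 2 ++ nseq m4 4))) \/
  (exists m2 m4 m6, 3 * m2 + 5 * m4 + 7 * m6 = n - 1 /\
     graph_iso e (pf_rel (1 :: nseq m2 2 ++ nseq m4 4 ++ nseq m6 6))) \/
  (6 <= n /\ graph_iso e graph_B) \/
  (7 <= n /\ graph_iso e graph_A) \/
  (8 <= n /\ graph_iso e graph_E).

(* Main.v *)
(* A minimal obstruction has no two vertices with the same neighbourhood, and a
   full colouring of such a twin-free graph is an induced embedding.  An induced
   subgraph of C_n on a vertex set S has at least 2|S| - n edges, because the
   vertices of S whose successor is not in S inject into the complement of S;
   hence a twin-free linear forest with paths of orders s_i embeds in C_n if and
   only if the sum of the s_i + 1 is at most n.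

   In a minimal obstruction without triangles, a 4-cycle together with vertices
   witnessing that opposite corners are not twins is A or B, and a vertex of
   degree 3 gives E or a 5-cycle.  Otherwise the degrees are at most 2, so the
   graph is a disjoint union of cycles and paths; a cycle component must be the
   whole graph.  For a linear forest, deleting an interior vertex of a path does
   not change the sum of the s_i + 1 unless it creates a path on three vertices
   or a second isolated vertex.  This leaves the orders 1, 2, 4 and 6, and the
   remaining deletions bound the excess of the sum over n by 1 or 2. *)
Require Import Defs.
From mathcomp Require Import all_boot.
From mathcomp Require Import zify.

Set Implicit Arguments.
Unset Strict Implicit.
Unset Printing Implicit Defensive.

(** * Full colourings by cycles *)

Definition adjn (i j : nat) : bool := (i.+1 == j) || (j.+1 == i).

Lemma adjn_sym : symmetric adjn.
Proof. by move=> i j; rewrite /adjn orbC. Qed.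

Lemma adjn_irr : irreflexive adjn.
Proof. by move=> i; rewrite /adjn; lia. Qed.

Lemma val_ordS m (i : 'I_m) :
  ordS i = (if i.+1 == m then 0 else i.+1) :> nat.
Proof.
rewrite /=; case: eqP => [->|ne]; first by rewrite modnn.
by rewrite modn_small //; have := ltn_ord i; lia.
Qed.

Lemma cycle_rel_ordS m (i j : 'I_m) :
  cycle_rel m i j = (j == ordS i) || (i == ordS j).
Proof. by []. Qed.

Lemma cycle_relE m (i j : 'I_m) : 2 < m ->
  cycle_rel m i j =
    [|| adjn i j, (i == 0 :> nat) && (j.+1 == m)
      | (j == 0 :> nat) && (i.+1 == m)].
Proof.
move=> m_gt2; rewrite cycle_rel_ordS /adjn.
rewrite -!(inj_eq val_inj) ![val (ordS _)]val_ordS.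
have [] := (ltn_ord i, ltn_ord j).
rewrite /=; move: (nat_of_ord i) (nat_of_ord j) => a b.
by case: (a.+1 =P m); case: (b.+1 =P m); lia.
Qed.

Section Colouring.

Variables (T U : finType) (e : rel T) (h : rel U).

(** The separating vertex must itself lie in [S], so the property can be lost when a vertex is
    deleted. *)
Definition twin_free (S : {set T}) : Prop :=
  forall x y, x \in S -> y \in S -> x != y ->
  exists2 z, z \in S & e x z != e y z.

Definition degree_sum (S : {set T}) : nat :=
  \sum_(x in S) \sum_(y in S) e x y.

Lemma full_colourableS (S S' : {set T}) :
  S \subset S' -> full_colourable_on e h S' -> full_colourable_on e h S.
Proof.
move=> /subsetP sSS' [f hom_f]; exists f => x y xS yS.
by apply: hom_f; apply: sSS'.
Qed.

Lemma minimalP :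
  ~ full_colourable_on e h [set: T] ->
  (forall v, full_colourable_on e h [set~ v]) -> minimal_obstruction e h.
Proof.
move=> ncol col; split=> // S /properP [_ [v _ vS]].
apply: full_colourableS (col v); apply/subsetP=> x xS.
by rewrite !inE; apply: contraNneq vS => <-.
Qed.

Lemma minimal_colourable v :
  minimal_obstruction e h -> full_colourable_on e h [set~ v].
Proof.
case=> _; apply; apply/properP; split; first exact: subsetT.
by exists v; rewrite !inE ?eqxx.
Qed.

Lemma twin_free_inj (S : {set T}) f :
  twin_free S -> full_hom_on e h S f -> {in S &, injective f}.
Proof.
move=> tfS hom_f x y xS yS eq_f; apply/eqP/negPn/negP => /(tfS x y xS yS).
by case=> z zS; rewrite !hom_f // eq_f eqxx.
Qed.

(** If [x] and [y] were twins, a colouring of the graph without [y] would extend by giving [y] the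
    colour of [x]. *)
Lemma minimal_twin_free :
  symmetric e -> minimal_obstruction e h -> twin_free [set: T].
Proof.
move=> e_sym min_e x y _ _ neq_xy.
have [/existsP[z ez]|/existsPn tw] := boolP [exists z, e x z != e y z].
  by exists z; rewrite ?inE.
have {}tw z : e x z = e y z by apply/eqP; rewrite -[_ == _]negbK tw.
have [f hom_f] := minimal_colourable y min_e.
case: min_e => ncol _; case: ncol.
exists (fun z => if z == y then f x else f z) => a b _ _.
have xNy : x \in [set~ y] by rewrite !inE.
have inNy c : c != y -> c \in [set~ y] by rewrite !inE.
have [->|/inNy aNy] := eqVneq a y; have [->|/inNy bNy] := eqVneq b y.
- by rewrite -hom_f // -tw e_sym -tw.
- by rewrite -hom_f // -tw.
- by rewrite -hom_f // e_sym -tw e_sym.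
- by rewrite -hom_f.
Qed.

End Colouring.

Lemma colourable_pull (T T' U : finType) (e : rel T) (e' : rel T') (h : rel U)
    (g : T' -> T) (S' : {set T'}) (S : {set T}) :
  (forall x y, e' x y = e (g x) (g y)) -> (forall x, x \in S' -> g x \in S) ->
  full_colourable_on e h S -> full_colourable_on e' h S'.
Proof.
move=> eE gS [f hom_f]; exists (f \o g) => x y xS yS /=.
by rewrite eE hom_f // gS.
Qed.

(** The image of [g] induces a non-colourable subgraph, so by minimality it is everything;
    twin-freeness makes [g] injective. *)
Lemma minimal_embedding_iso (T T' U : finType) (e : rel T) (e' : rel T')
    (h : rel U) (g : T' -> T) :
  minimal_obstruction e h -> ~ full_colourable_on e' h [set: T'] ->
  twin_free e' [set: T'] -> (forall x y, e' x y = e (g x) (g y)) ->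
  graph_iso e e'.
Proof.
move=> [_ col] ncol tf eE.
have g_inj : injective g.
  by move=> x y; apply: (twin_free_inj (h := e) tf); rewrite ?inE.
have [gP|] := boolP (g @: [set: T'] \proper [set: T]).
  case: ncol; apply: (colourable_pull eE _ (col _ gP)) => x _.
  by apply: imset_f; rewrite inE.
rewrite properE subsetT /= negbK => /subsetP surj.
have [|f gK fK] := @inj_card_bij _ _ g g_inj.
  rewrite -(card_imset predT g_inj) -cardsT; apply: subset_leq_card.
  by apply/subsetP => x /surj /imsetP [y _ ->]; apply: imset_f.
exists f; split; first by exists g.
by move=> x y; rewrite eE !fK.
Qed.

Lemma minimal_iso (T T' U : finType) (e : rel T) (e' : rel T') (h : rel U) :
  graph_iso e e' -> minimal_obstruction e' h -> minimal_obstruction e h.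
Proof.
move=> [f [[g fK gK] eE]] min_e'.
have eE' x y : e' x y = e (g x) (g y) by rewrite eE !gK.
apply: minimalP => [|v].
  case: (min_e') => ncol _ /(colourable_pull eE') H; apply: ncol.
  by apply: H => x; rewrite !inE.
have := minimal_colourable (f v) min_e'; apply: colourable_pull eE _ => x.
by rewrite !inE (can_eq fK).
Qed.

Lemma graph_iso_sym (T T' : finType) (e : rel T) (e' : rel T') :
  graph_iso e e' -> graph_iso e' e.
Proof.
move=> [f [[g fK gK] eE]]; exists g; split; first by exists f.
by move=> x y; rewrite eE !gK.
Qed.

(* Positions up to [n - 2] leave the vertex [n - 1] of the cycle free, so the
   cycle restricts to a path there. *)
Lemma position_colouring (T : finType) (e : rel T) (S : {set T}) n
    (phi : T -> nat) :
  4 < n -> (forall x, x \in S -> (phi x).+2 <= n) ->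
  (forall x y, x \in S -> y \in S -> e x y = adjn (phi x) (phi y)) ->
  full_colourable_on e (cycle_rel n) S.
Proof.
move=> n_gt4 phi_lt eE; case: n n_gt4 phi_lt => // n n_gt4 phi_lt.
exists (fun x => inord (phi x)) => x y xS yS.
have [ltx lty] := (phi_lt x xS, phi_lt y yS).
rewrite cycle_relE; last by lia.
by rewrite eE // !inordK; lia.
Qed.

(* The vertices of [A] whose successor is not in [A] inject into the complement
   of [A], so [#|A|] exceeds the number of edges inside [A] by at most
   [n - #|A|]. *)
Lemma degree_sum_cycle (n : nat) (A : {set 'I_n}) : 2 < n ->
  4 * #|A| <= 2 * n + degree_sum (cycle_rel n) A.
Proof.
(* [B] collects the vertices whose successor lies in [A]. It is as large as [A], and [#|A :&: B|]
   counts the cycle edges inside [A]. *)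
move=> n_gt2; rewrite /degree_sum; set B := @ordS n @^-1: A.
have succE a : \sum_(b in A) (b == ordS a : nat) = (a \in B).
  rewrite inE; have [aA|aA] := boolP (ordS a \in A).
    by rewrite (bigD1 _ aA) /= eqxx big1 // => b /andP [_ /negPf ->].
  by rewrite big1 // => b bA; case: eqP => // bE; rewrite -bE bA in aA.
(* Since [n > 2], the two disjuncts exclude each other. *)
have splitE (a b : 'I_n) :
    (cycle_rel n a b : nat) = (b == ordS a) + (a == ordS b).
  rewrite cycle_rel_ordS -!(inj_eq val_inj) ![val (ordS _)]val_ordS.
  have [] := (ltn_ord a, ltn_ord b).
  rewrite /=; move: (nat_of_ord a) (nat_of_ord b) => i j.
  by case: (i.+1 =P n); case: (j.+1 =P n); lia.
have sumB : \sum_(a in A) (a \in B : nat) = #|A :&: B|.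
  rewrite -sum1_card [RHS](eq_bigl (fun a => (a \in A) && (a \in B))) => [|a].
    by rewrite big_mkcondr; apply: eq_bigr => a _; case: (a \in B).
  by rewrite inE.
have -> : \sum_(a in A) \sum_(b in A) (cycle_rel n a b : nat) = 2 * #|A :&: B|.
  under eq_bigr do under eq_bigr do rewrite splitE.
  under eq_bigr do rewrite big_split succE.
  rewrite big_split /= sumB exchange_big /=.
  under [X in _ + X]eq_bigr do rewrite succE.
  by rewrite sumB mul2n addnn.
have : #|B| = #|A| by apply: card_preimset; apply: ordS_inj.
have : #|A :|: B| <= n by rewrite -[X in _ <= X]card_ord max_card.
move=> leU eqB; have := cardsUI A B; rewrite eqB addnn -mul2n => UI.
by rewrite -[4]/(2 * 2) -mulnA -UI mulnDr leq_add2r leq_mul2l leU.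
Qed.

Lemma injective_degree_sum (T : finType) (e : rel T) n (S : {set T})
    (f : T -> 'I_n) :
  2 < n -> full_hom_on e (cycle_rel n) S f -> {in S &, injective f} ->
  4 * #|S| <= 2 * n + degree_sum e S.
Proof.
move=> n_gt2 hom_f f_inj.
rewrite -(card_in_imset f_inj); have := degree_sum_cycle (f @: S) n_gt2.
congr (_ <= _ + _); rewrite /degree_sum big_imset //=.
apply: eq_bigr => x xS; rewrite big_imset //=.
by apply: eq_bigr => y yS; rewrite hom_f.
Qed.

Lemma not_colourable (T : finType) (e : rel T) n (S : {set T}) :
  2 < n -> twin_free e S -> 2 * n + degree_sum e S < 4 * #|S| ->
  ~ full_colourable_on e (cycle_rel n) S.
Proof.
move=> n_gt2 tfS lt [f hom_f].
have := injective_degree_sum n_gt2 hom_f (twin_free_inj tfS hom_f); lia.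
Qed.

Definition degree (T : finType) (e : rel T) (x : T) : nat :=
  \sum_(y : T) e x y.

Lemma degreeE (T : finType) (e : rel T) x : degree e x = #|[pred y | e x y]|.
Proof.
rewrite /degree -sum1_card [RHS]big_mkcond.
by apply: eq_bigr => y _; rewrite inE; case: (e x y).
Qed.

Lemma degree_sumT (T : finType) (e : rel T) :
  degree_sum e [set: T] = \sum_x degree e x.
Proof.
rewrite /degree_sum /degree; apply: eq_big => [x|x _]; first by rewrite inE.
by apply: eq_bigl => y; rewrite inE.
Qed.

Lemma degree_sumD1 (T : finType) (e : rel T) v :
  symmetric e -> irreflexive e ->
  degree_sum e [set: T] = degree_sum e [set~ v] + 2 * degree e v.
Proof.
move=> e_sym e_irr; rewrite degree_sumT /degree_sum /degree.
have cutE (F : T -> nat) : \sum_(x in [set~ v]) F x + F v = \sum_x F x.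
  rewrite addnC [in RHS](bigD1 v) //=; congr (_ + _).
  by apply: eq_bigl => x; rewrite !inE.
rewrite -(cutE (fun x => \sum_y (e x y : nat))).
under [X in X + _ = _]eq_bigr do rewrite -(cutE (fun y => e _ y : nat)).
rewrite big_split /=.
have -> : \sum_(x in [set~ v]) (e x v : nat) = \sum_y (e v y : nat).
  rewrite -(cutE (fun y => e v y : nat)) e_irr addn0.
  by apply: eq_bigr => x _; rewrite e_sym.
by rewrite mul2n -addnn addnA.
Qed.

(** The graph without [v] embeds in the cycle, and the edge count is applied to that embedding. This
    bounds [n] from below for a given obstruction. *)
Lemma minimal_degree_sum (T : finType) (e : rel T) n v :
  2 < n -> symmetric e -> irreflexive e ->
  minimal_obstruction e (cycle_rel n) -> twin_free e [set~ v] ->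
  4 * #|T| + 2 * degree e v <= 2 * n + degree_sum e [set: T] + 4.
Proof.
move=> n_gt2 e_sym e_irr min_e tf.
have [f hom_f] := minimal_colourable v min_e.
have := injective_degree_sum n_gt2 hom_f (twin_free_inj tf hom_f).
rewrite (degree_sumD1 v e_sym e_irr) cardsC1.
have := fintype0 v; case: #|T| (cardC1 v) => //=; lia.
Qed.

(** * Cycles and the six-vertex obstructions *)

(** Only the successor and the predecessor are neighbours, so two distinct ones exhaust them. *)
Lemma cycle_rel_nbrs n (a b c d : 'I_n) : b != c ->
  cycle_rel n a b -> cycle_rel n a c -> cycle_rel n a d -> (d == b) || (d == c).
Proof.
rewrite !cycle_rel_ordS => neq_bc.
have ordSE (u v : 'I_n) : (u == ordS v) = (ord_pred u == v).
  by rewrite -{1}(ord_predK u) (inj_eq (@ordS_inj n)).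
rewrite !(ordSE a) ![ord_pred a == _]eq_sym.
move=> /orP [] /eqP eb /orP [] /eqP ec /orP [] /eqP ed;
  by rewrite ed -?eb -?ec ?eqxx ?orbT // eb ec eqxx in neq_bc *.
Qed.

Lemma val_ord_pred m (i : 'I_m) :
  ord_pred i = (if i == 0 :> nat then m.-1 else i.-1) :> nat.
Proof.
rewrite /=; have := ltn_ord i; case: eqP => [-> ?|ne ltim].
  by rewrite add0n modn_small //; lia.
have -> : (i + m).-1 = i.-1 + m by lia.
by rewrite modnDr modn_small //; lia.
Qed.

Lemma cycle_twin_free m : (m == 3) || (4 < m) ->
  twin_free (cycle_rel m) [set: 'I_m].
Proof.
move=> m_ok x y _ _ neq_xy.
have m_gt2 : 2 < m by lia.
have [ltx lty] := (ltn_ord x, ltn_ord y).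
have {}neq_xy : x != y :> nat by [].
have wit (z : 'I_m) : cycle_rel m x z != cycle_rel m y z ->
    exists2 z, z \in [set: 'I_m] & cycle_rel m x z != cycle_rel m y z.
  by exists z; rewrite ?inE.
have [yS|nyS] := boolP (cycle_rel m y (ordS x)); last first.
  apply: (wit (ordS x)); apply: contraNneq nyS => <-.
  by rewrite cycle_rel_ordS eqxx.
(* If [y] is adjacent to both neighbours of [x], it lies two steps from [x] either way round, so
   [m = 4]. *)
apply: (wit (ord_pred x)); move: yS.
rewrite !cycle_relE // /adjn val_ordS val_ord_pred.
by case: (x.+1 =P m); case: (x =P 0 :> nat); lia.
Qed.

(** A colouring is injective, so each vertex of its image has two neighbours in the image, one of
    them its successor. The image is then all of [C_n], which has more than [m] vertices. *)
Lemma cycle_not_colourable m n : 4 < n -> (m == 3) || (4 < m < n) ->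
  ~ full_colourable_on (cycle_rel m) (cycle_rel n) [set: 'I_m].
Proof.
move=> n_gt4 m_ok [f hom_f].
have f_inj : injective f.
  move=> x y; apply: (twin_free_inj _ hom_f); rewrite ?inE //.
  by apply: cycle_twin_free; lia.
have m_gt2 : 2 < m by lia.
have ltmn : m < n by lia.
have closed x : exists y, f y = ordS (f x).
  have nbr y : cycle_rel m x y -> cycle_rel n (f x) (f y) by rewrite hom_f ?inE.
  have neqSP : ordS x != ord_pred x.
    rewrite -(inj_eq val_inj) [val (ordS x)]val_ordS [val _]val_ord_pred.
    by have := ltn_ord x; case: (x.+1 =P m); case: (x =P 0 :> nat); lia.
  have adjS : cycle_rel m x (ordS x) by rewrite cycle_rel_ordS eqxx.
  have adjP : cycle_rel m x (ord_pred x).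
    by rewrite cycle_rel_ordS ord_predK eqxx orbT.
  have neqf : f (ordS x) != f (ord_pred x) by rewrite (inj_eq f_inj).
  have /orP[/eqP ->|/eqP ->] :=
      cycle_rel_nbrs (d := ordS (f x)) neqf (nbr _ adjS) (nbr _ adjP)
        (introT orP (or_introl (eqxx _))).
    by exists (ordS x).
  by exists (ord_pred x).
have m_gt0 : 0 < m by lia.
have iterE k : exists y, f y = iter k (@ordS n) (f (Ordinal m_gt0)).
  elim: k => [|k [y yE]]; first by exists (Ordinal m_gt0).
  by have [z zE] := closed y; exists z; rewrite zE yE.
have valE k (a : 'I_n) : iter k (@ordS n) a = (a + k) %% n :> nat.
  elim: k => [|k IHk] /=; first by rewrite addn0 modn_small.
  by rewrite IHk -addn1 modnDml addn1 addnS.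
have : #|[set: 'I_n]| <= #|f @: [set: 'I_m]|.
  apply/subset_leq_card/subsetP => a _.
  (* This many successor steps from the image of vertex 0 arrive at [a] modulo [n], with no
     subtraction that could truncate. *)
  have [y yE] := iterE (a + (n - f (Ordinal m_gt0))).
  apply/imsetP; exists y; rewrite ?inE //; apply: val_inj.
  rewrite yE /= valE addnCA subnKC ?modnDr ?modn_small //.
  exact/ltnW.
by rewrite card_imset // !cardsT !card_ord leqNgt ltmn.
Qed.

Lemma cycle_minimal m n : 4 < n -> (m == 3) || (4 < m < n) ->
  minimal_obstruction (cycle_rel m) (cycle_rel n).
Proof.
move=> n_gt4 m_ok; apply: minimalP => [|v]; first exact: cycle_not_colourable.
(* Without [v] the cycle is a path; positions are counted onwards from the successor of [v]. *)
apply: (@position_colouring _ _ _ _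
  (fun x : 'I_m => if x < v then x + m - v.+1 else x - v.+1)) => // [x|x y].
  rewrite !inE -(inj_eq val_inj) /= => neq.
  have := ltn_ord x; have := ltn_ord v.
  by case: ifP; lia.
rewrite !inE -!(inj_eq val_inj) /= => neqx neqy.
rewrite cycle_relE; last by lia.
have := ltn_ord x; have := ltn_ord y; have := ltn_ord v.
by rewrite /adjn; case: ifP; case: ifP; lia.
Qed.

(** * Six-vertex graphs checked by computation *)

Section SixVertices.

Variable l : seq (nat * nat).

Let adjl i j := ((i, j) \in l) || ((j, i) \in l).

Definition twin_free_seq (vs : seq nat) : bool :=
  all (fun x => all (fun y =>
    (x == y) || has (fun z => adjl x z != adjl y z) vs) vs) vs.

(* [nth 0 tab x] is the position of [x] in the path [0, ..., b] when the vertex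
   [v] is deleted; the entry at [v] itself is arbitrary (9 in the tables below). *)
Definition position_table (b v : nat) (tab : seq nat) : bool :=
  all (fun x => (x == v) || (nth 0 tab x <= b) && all (fun y =>
    (y == v) || (adjl x y == adjn (nth 0 tab x) (nth 0 tab y)))
    (iota 0 6)) (iota 0 6).

Let iotaP (x : 'I_6) : val x \in iota 0 6.
Proof. by rewrite mem_iota /= ltn_ord. Qed.

Lemma edges_twin_free (S : {set 'I_6}) (vs : seq nat) :
  all (fun x => x < 6) vs -> (forall x, (x \in S) = (val x \in vs)) ->
  twin_free_seq vs -> twin_free (edges_rel l) S.
Proof.
move=> lt6 SE all_l x y; rewrite !SE => xvs yvs neq.
case/orP: (allP (allP all_l _ xvs) _ yvs) => [/eqP/val_inj eq_xy|].
  by rewrite eq_xy eqxx in neq.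
by case/hasP => z zvs ez; exists (Ordinal (allP lt6 _ zvs)); rewrite ?SE.
Qed.

Lemma edges_twin_freeT : twin_free_seq (iota 0 6) ->
  twin_free (edges_rel l) [set: 'I_6].
Proof. by apply: edges_twin_free => // x; rewrite in_setT iotaP. Qed.

Lemma edges_colourable n (v : 'I_6) (tab : seq nat) b :
  4 < n -> b.+2 <= n -> position_table b v tab ->
  full_colourable_on (edges_rel l) (cycle_rel n) [set~ v].
Proof.
move=> n_gt4 leb all_l; have H := allP all_l.
apply: (@position_colouring _ _ _ _ (fun x : 'I_6 => nth 0 tab (val x))) => //.
  move=> x; rewrite !inE => /negPf neq.
  have := H _ (iotaP x); rewrite (inj_eq val_inj) neq orFb => /andP [le _].
  by apply: leq_trans leb; rewrite !ltnS.
move=> x y; rewrite !inE => /negPf neqx /negPf neqy.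
have := H _ (iotaP x); rewrite (inj_eq val_inj) neqx orFb => /andP [_ H'].
by have := allP H' _ (iotaP y); rewrite (inj_eq val_inj) neqy orFb => /eqP <-.
Qed.

(* The vertex [1] has the three neighbours [0], [2] and [4]. *)
Lemma edges_not_colourable n : 4 < n -> twin_free_seq (iota 0 6) ->
  [&& (0, 1) \in l, (1, 2) \in l & (1, 4) \in l] ->
  ~ full_colourable_on (edges_rel l) (cycle_rel n) [set: 'I_6].
Proof.
move=> n_gt4 tf /and3P [l0 l2 l4] [f hom_f].
have f_inj : injective f.
  by move=> x y; apply: (twin_free_inj (edges_twin_freeT tf) hom_f);
    rewrite inE.
pose o (k : nat) (lt : k < 6) : 'I_6 := Ordinal lt.
have := @cycle_rel_nbrs n (f (@o 1 isT))
  (f (@o 0 isT)) (f (@o 2 isT)) (f (@o 4 isT)).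
rewrite -!hom_f ?inE // !(inj_eq f_inj) /edges_rel /=.
by rewrite l0 l2 l4 orbT => /(_ isT isT isT isT).
Qed.

Lemma edges_minimal n b (tabs : seq (seq nat)) :
  4 < n -> b.+2 <= n -> twin_free_seq (iota 0 6) ->
  all (fun v => position_table b v (nth [::] tabs v)) (iota 0 6) ->
  [&& (0, 1) \in l, (1, 2) \in l & (1, 4) \in l] ->
  minimal_obstruction (edges_rel l) (cycle_rel n).
Proof.
move=> n_gt4 leb tf col l_nbrs.
apply: minimalP => [|v]; first exact: edges_not_colourable.
exact: edges_colourable n_gt4 leb (allP col _ (iotaP v)).
Qed.

Lemma edges_sym : symmetric (edges_rel l).
Proof. by move=> x y; rewrite /edges_rel orbC. Qed.

Lemma edges_irr : all (fun x => ~~ adjl x x) (iota 0 6) ->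
  irreflexive (edges_rel l).
Proof. by move=> irr x; apply/negbTE; apply: (allP irr _ (iotaP x)). Qed.

(* Counts the vertices and edges that remain after deleting the vertex [1]. *)
Lemma edges_minimal_bound n : 4 < n ->
  twin_free_seq [:: 0; 2; 3; 4; 5] ->
  all (fun x => ~~ adjl x x) (iota 0 6) ->
  minimal_obstruction (edges_rel l) (cycle_rel n) ->
  20 + 2 * sumn [seq adjl 1 y : nat | y <- iota 0 6] <=
  2 * n + sumn [seq sumn [seq adjl x y : nat | y <- iota 0 6] | x <- iota 0 6].
Proof.
move=> n_gt4 tf irr min_l; pose v := @Ordinal 6 1 isT.
have n_gt2 : 2 < n by apply: leq_trans n_gt4.
have tfv : twin_free (edges_rel l) [set~ v].
  apply: edges_twin_free tf => // x; rewrite !inE -(inj_eq val_inj) /=.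
  by case: x => [[|[|[|[|[|[|[]]]]]]]].
have sumE (F : nat -> nat) :
    \sum_(x < 6) F x = sumn [seq F x | x <- iota 0 6].
  by rewrite sumnE big_map -[iota 0 6]/(index_iota 0 6) big_mkord.
pose deg i := sumn [seq adjl i y : nat | y <- iota 0 6].
have degE (x : 'I_6) : degree (edges_rel l) x = deg x.
  exact: (sumE (fun y => adjl x y)).
have := minimal_degree_sum n_gt2 edges_sym (edges_irr irr) min_l tfv.
rewrite degree_sumT card_ord degE (eq_bigr _ (fun x _ => degE x)).
rewrite (sumE deg) => H.
have {}H :
  4 * 6 + 2 * deg 1 <= 2 * n + sumn [seq deg x | x <- iota 0 6] + 4 := H.
(* The constant is [4 * 6 - 4]. *)
change (20 + 2 * deg 1 <= 2 * n + sumn [seq deg x | x <- iota 0 6]).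
move: (deg 1) (sumn _) H => d sm; lia.
Qed.

End SixVertices.

(** Equal entries in a row merge vertices that the deletion has made twins. Deleting [1] leaves
    [K_1 + P_4] at positions 0 and 2 to 5, hence the bound 5. *)
Lemma graph_A_minimal n : 6 < n -> minimal_obstruction graph_A (cycle_rel n).
Proof.
move=> n_gt6; apply: (@edges_minimal _ _ 5
  [:: [:: 9; 2; 3; 2; 1; 0]; [:: 0; 9; 2; 3; 4; 5]; [:: 0; 1; 9; 3; 2; 3];
      [:: 3; 2; 3; 9; 1; 0]; [:: 2; 3; 4; 5; 9; 0]; [:: 0; 1; 2; 3; 2; 9]]) => //.
by apply: leq_trans n_gt6.
Qed.

(** Deleting [1] leaves [P_5], whose last position is 4. *)
Lemma graph_B_minimal n : 5 < n -> minimal_obstruction graph_B (cycle_rel n).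
Proof.
move=> n_gt5; apply: (@edges_minimal _ _ 4
  [:: [:: 9; 1; 0; 1; 2; 3]; [:: 0; 9; 4; 3; 2; 1]; [:: 3; 2; 9; 0; 1; 2];
      [:: 2; 1; 0; 9; 2; 3]; [:: 1; 2; 3; 4; 9; 0]; [:: 0; 1; 2; 3; 2; 9]]) => //.
by apply: leq_trans n_gt5.
Qed.

(** Deleting [1] leaves [K_1 + 2K_2], spread over positions 0 to 6 with gaps at 1 and 4. *)
Lemma graph_E_minimal n : 7 < n -> minimal_obstruction graph_E (cycle_rel n).
Proof.
move=> n_gt7; apply: (@edges_minimal _ _ 6
  [:: [:: 9; 3; 4; 5; 2; 0]; [:: 2; 9; 5; 6; 0; 3]; [:: 3; 4; 9; 0; 5; 2];
      [:: 2; 1; 0; 9; 0; 3]; [:: 1; 2; 3; 4; 9; 0]; [:: 0; 1; 2; 3; 0; 9]]) => //.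
by apply: leq_trans n_gt7.
Qed.

(** * Linear forests *)

Section PathForest.

Variable s : seq nat.

Implicit Types x y z v : pf_vert s.

Definition pf_comp x : nat := tag x.
Definition pf_pos x : nat := tagged x.

Lemma pf_comp_lt x : pf_comp x < size s. Proof. exact: ltn_ord. Qed.
Lemma pf_pos_lt x : pf_pos x < nth 0 s (pf_comp x). Proof. exact: ltn_ord. Qed.

Lemma pf_relE x y :
  pf_rel s x y = (pf_comp x == pf_comp y) && adjn (pf_pos x) (pf_pos y).
Proof. by []. Qed.

Lemma pf_eqE x y :
  (x == y) = (pf_comp x == pf_comp y) && (pf_pos x == pf_pos y).
Proof.
apply/eqP/andP => [->|[/eqP]]; first by rewrite !eqxx.
case: x y => [i j] [i' j'] /val_inj /= eq_i; move: j'.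
rewrite /pf_comp /pf_pos /=; case: i' / eq_i => j' /eqP /val_inj /= ->.
by [].
Qed.

Lemma pf_ex i j : i < size s -> j < nth 0 s i ->
  exists x, pf_comp x = i /\ pf_pos x = j.
Proof.
move=> lti ltj.
by exists (Tagged (fun i : 'I_(size s) => 'I_(nth 0 s i)) (i := Ordinal lti)
  (Ordinal ltj)).
Qed.

Lemma pf_rel_sym : symmetric (pf_rel s).
Proof. by move=> x y; rewrite !pf_relE /adjn; lia. Qed.

Lemma pf_rel_irr : irreflexive (pf_rel s).
Proof. by move=> x; rewrite pf_relE /adjn; lia. Qed.

Lemma pf_sum (F : nat -> nat -> nat) :
  \sum_x F (pf_comp x) (pf_pos x) =
  \sum_(i < size s) \sum_(j < nth 0 s i) F i j.
Proof. by rewrite sig_big_dep. Qed.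

Lemma card_pf_vert : #|pf_vert s| = sumn s.
Proof.
rewrite -sum1_card (pf_sum (fun _ _ => 1)).
under eq_bigr do rewrite sum_nat_const card_ord muln1.
by rewrite sumnE (big_nth 0) big_mkord.
Qed.

Lemma degree_pf x :
  degree (pf_rel s) x = (0 < pf_pos x) + ((pf_pos x).+1 < nth 0 s (pf_comp x)).
Proof.
rewrite /degree.
have unique i j : \sum_y ((pf_comp y == i) && (pf_pos y == j) : nat) =
    (i < size s) && (j < nth 0 s i).
  have [/andP [lti ltj]|nlt] := boolP (_ && _).
    have [y [<- <-]] := pf_ex lti ltj.
    rewrite (bigD1 y) //= !eqxx big1 // => z; rewrite pf_eqE.
    by move=> /negPf ->.
  rewrite big1 // => y _; apply/eqP; rewrite eqb0; apply: contra nlt.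
  by case/andP => /eqP <- /eqP <-; rewrite pf_comp_lt pf_pos_lt.
have splitE y : (pf_rel s x y : nat) =
    ((pf_comp y == pf_comp x) && (pf_pos y == (pf_pos x).+1)) +
    ((0 < pf_pos x) &&
      ((pf_comp y == pf_comp x) && (pf_pos y == (pf_pos x).-1))).
  by rewrite pf_relE /adjn; lia.
under eq_bigr do rewrite splitE.
rewrite big_split /= unique pf_comp_lt addnC; congr (_ + _).
case: posnP => [->|pos_gt0]; first by rewrite big1.
by rewrite unique pf_comp_lt /=; have := pf_pos_lt x; lia.
Qed.

(** A path of order [k >= 1] has [k - 1] edges; an empty path would break the formula. *)
Lemma degree_sum_pf : all (leq 1) s ->
  degree_sum (pf_rel s) [set: pf_vert s] + 2 * size s = 2 * sumn s.
Proof.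
move=> /all_nthP s_gt0; rewrite degree_sumT; under eq_bigr do rewrite degree_pf.
rewrite (pf_sum (fun i j => (0 < j) + (j.+1 < nth 0 s i))).
have segE k : 0 < k -> \sum_(j < k) ((0 < j) + (j.+1 < k)) + 2 = 2 * k.
  case: k => // k _; rewrite big_split /=.
  have -> : \sum_(j < k.+1) (0 < j : nat) = k.
    by rewrite big_ord_recl /= add0n sum_nat_const card_ord muln1.
  rewrite big_ord_recr /= ltnn addn0 (eq_bigr (fun=> 1)) => [|j _].
    by rewrite sum_nat_const card_ord; lia.
  by rewrite ltnS ltn_ord.
have -> : 2 * size s = \sum_(i < size s) 2.
  by rewrite sum_nat_const card_ord mulnC.
rewrite -big_split /= sumnE (big_nth 0) big_mkord big_distrr /=.
by apply: eq_bigr => i _; rewrite segE // s_gt0.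
Qed.

Definition single_K1 : Prop := forall i i', i < size s -> i' < size s ->
  nth 0 s i = 1 -> nth 0 s i' = 1 -> i = i'.

(** In a linear forest, only two isolated vertices or the two ends of a [P_3] can be twins. *)
Lemma pf_twin_free : single_K1 -> 3 \notin s ->
  twin_free (pf_rel s) [set: pf_vert s].
Proof.
move=> s1 s3 x y _ _.
wlog lt_xy : x y / (pf_comp x == pf_comp y) ==> (pf_pos x < pf_pos y).
  move=> H neq.
  have [/H|nlt] := boolP ((pf_comp x == pf_comp y) ==> (pf_pos x < pf_pos y)).
    exact.
  have [||z zT ez] := H y x; [|by rewrite eq_sym|by exists z; rewrite // eq_sym].
  by move: neq nlt; rewrite pf_eqE; lia.
rewrite pf_eqE => neq; have [ltx lty] := (pf_pos_lt x, pf_pos_lt y).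
have nth3 z : nth 0 s (pf_comp z) != 3.
  by apply: contraNneq s3 => <-; rewrite mem_nth ?pf_comp_lt.
have wit i j : i < size s -> j < nth 0 s i ->
    ((pf_comp x == i) && adjn (pf_pos x) j) !=
      ((pf_comp y == i) && adjn (pf_pos y) j) ->
    exists2 z, z \in [set: pf_vert s] & pf_rel s x z != pf_rel s y z.
  move=> lti ltj; have [z [<- <-]] := pf_ex lti ltj.
  by exists z; rewrite ?inE.
have [eq_c|neq_c] := eqVneq (pf_comp x) (pf_comp y); last first.
  have [x1|x1] := eqVneq (nth 0 s (pf_comp x)) 1.
    have y1 : nth 0 s (pf_comp y) != 1.
      apply: contraNneq neq_c => y1.
      by rewrite (s1 _ _ (pf_comp_lt x) (pf_comp_lt y)).
    by apply: (wit (pf_comp y) (if pf_pos y == 0 then 1 else (pf_pos y).-1)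
        (pf_comp_lt y));
      rewrite /adjn; case: ifP; lia.
  by apply: (wit (pf_comp x) (if pf_pos x == 0 then 1 else (pf_pos x).-1)
      (pf_comp_lt x));
    rewrite /adjn; case: ifP; lia.
have {}lt_xy : pf_pos x < pf_pos y by rewrite eq_c eqxx in lt_xy.
rewrite -eq_c in lty.
have := nth3 x => nth3x.
(* With [x] before [y] on one path, try the vertex before [x], then the one after [y]. If neither
   exists, [x] and [y] are the ends, and the vertex before [y] works unless the order is 3. *)
have [x0|x_gt0] := posnP (pf_pos x); last first.
  by apply: (wit _ (pf_pos x).-1 (pf_comp_lt x)); rewrite -?eq_c /adjn; lia.
have [lt|ge] := ltnP (pf_pos y).+1 (nth 0 s (pf_comp x)).
  by apply: (wit _ (pf_pos y).+1 (pf_comp_lt x)); rewrite -?eq_c /adjn; lia.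
apply: (wit _ (pf_pos y).-1 (pf_comp_lt x)); rewrite -?eq_c /adjn; lia.
Qed.

(* [l] and [r] are the orders of the two paths that remain of the component of
   the deleted vertex. *)
Lemma pf_twin_freeD1 v (l := pf_pos v)
    (r := nth 0 s (pf_comp v) - (pf_pos v).+1) :
  single_K1 -> 3 \notin s -> l != 3 -> r != 3 ->
  ((l == 1) || (r == 1)) ==> (1 \notin s) ->
  twin_free (pf_rel s) [set~ v].
Proof.
move=> s1 s3 l3 r3 lr1 x y xv yv neq.
have [z _ ez] := pf_twin_free s1 s3 (in_setT x) (in_setT y) neq.
have [zv|zv] := eqVneq z v; last by exists z; rewrite // !inE.
rewrite {z}zv in ez.
wlog xz : x y xv yv neq ez / pf_rel s x v && ~~ pf_rel s y v.
  move=> H; have [/H|nxz] := boolP (pf_rel s x v && ~~ pf_rel s y v).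
    exact.
  have [|||z zv ez'] := H y x yv xv; last by exists z; rewrite // eq_sym.
  - by rewrite eq_sym.
  - by rewrite eq_sym.
  - by move: ez nxz; case: (pf_rel s x v); case: (pf_rel s y v).
case/andP: xz; rewrite !pf_relE => /andP [/eqP eq_xv adj_xv] nadj_yv.
have [[ltx lty] ltv] := (pf_pos_lt x, pf_pos_lt y, pf_pos_lt v).
have wit i j : i < size s -> j < nth 0 s i ->
    ~~ ((i == pf_comp v) && (j == pf_pos v)) ->
    ((pf_comp x == i) && adjn (pf_pos x) j) !=
      ((pf_comp y == i) && adjn (pf_pos y) j) ->
    exists2 z, z \in [set~ v] & pf_rel s x z != pf_rel s y z.
  move=> lti ltj; have [z [<- <-]] := pf_ex lti ltj => zv neq_z.
  by exists z; rewrite // !inE pf_eqE.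
have y1 : (l == 1) || (r == 1) -> nth 0 s (pf_comp y) != 1.
  move=> H; apply: contraTneq (implyP lr1 H) => <-.
  by rewrite negbK mem_nth ?pf_comp_lt.
(* For the case that [x] is left isolated: a neighbour of [y] in its own path separates them, that
   path not being a [K_1]. *)
have far : pf_comp y != pf_comp v -> (l == 1) || (r == 1) ->
    exists2 z, z \in [set~ v] & pf_rel s x z != pf_rel s y z.
  move=> neq_yv /y1 py.
  apply: (wit _ (if pf_pos y == 0 then 1 else (pf_pos y).-1) (pf_comp_lt y)).
  - by clear - py lty; case: ifP; lia.
  - by rewrite (negPf neq_yv).
  - by rewrite eq_xv [pf_comp v == _]eq_sym (negPf neq_yv) eqxx /adjn /=;
      clear - py lty; case: ifP; lia.
move: xv yv neq nadj_yv; rewrite !inE !pf_eqE eq_xv eqxx /= => xv yv neq nadj_yv.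
rewrite eq_xv in ltx.
have wit_v j : j < nth 0 s (pf_comp v) -> j != pf_pos v ->
    adjn (pf_pos x) j != ((pf_comp y == pf_comp v) && adjn (pf_pos y) j) ->
    exists2 z, z \in [set~ v] & pf_rel s x z != pf_rel s y z.
  move=> ltj jv; rewrite eq_sym => ne; apply: (wit (pf_comp v) j);
    by rewrite ?pf_comp_lt ?eq_xv ?eqxx // eq_sym.
clear wit lr1 y1 s1 s3 ez; rewrite /l in l3; rewrite /r in r3.
case/orP: adj_xv => /eqP adj_xv.
- have [l1|l_gt1] := leqP (pf_pos v) 1.
    have [eq_yv|/far] := eqVneq (pf_comp y) (pf_comp v); last first.
      by apply; rewrite /l; lia.
    rewrite eq_yv eqxx in lty neq yv nadj_yv wit_v.
    by apply: (wit_v (pf_pos y).-1); rewrite /adjn in nadj_yv *; lia.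
  (* The vertex two before [v] is a neighbour of [x]. It fails only if [y] is three before [v], and
     then position [pf_pos v - 4] separates. When [pf_pos v] is 2, these differences truncate to 0,
     the position of [y] itself, which is adjacent to [x]. *)
  have [/andP [/eqP eq_yv y3]|ny3] :=
      boolP ((pf_comp y == pf_comp v) && (pf_pos y == pf_pos v - 3)); last first.
    by apply: (wit_v (pf_pos v - 2)); clear far l r l3 r3; rewrite /adjn; lia.
  rewrite eq_yv eqxx in lty neq yv nadj_yv wit_v.
  by apply: (wit_v (pf_pos v - 4)); clear far l r; rewrite /adjn in nadj_yv *; lia.
- have [l1|l_gt1] := leqP (nth 0 s (pf_comp v) - (pf_pos v).+1) 1.
    have [eq_yv|/far] := eqVneq (pf_comp y) (pf_comp v); last first.
      by apply; rewrite /r; lia.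
    rewrite eq_yv eqxx in lty neq yv nadj_yv wit_v.
    by apply: (wit_v (pf_pos y).+1); rewrite /adjn in nadj_yv *; lia.
  have [/andP [/eqP eq_yv y3]|ny3] :=
      boolP ((pf_comp y == pf_comp v) && (pf_pos y == pf_pos v + 3)); last first.
    by apply: (wit_v (pf_pos v + 2)); clear far l r l3 r3; rewrite /adjn; lia.
  rewrite eq_yv eqxx in lty neq yv nadj_yv wit_v.
  by apply: (wit_v (pf_pos v + 4)); clear far l r; rewrite /adjn in nadj_yv *; lia.
Qed.

(* The paths are laid out along the cycle with one free vertex between
   consecutive ones; [offset i] is the position of the first vertex of the
   [i]-th path. *)
Definition offset i := sumn (take i s) + i.

Lemma offset_lt i i' : i < i' -> i' <= size s ->
  offset i + (nth 0 s i).+1 <= offset i'.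
Proof.
rewrite /offset; elim: i' => // i' IHi; rewrite ltnS => le_ii' lti'.
rewrite (take_nth 0) // -cats1 sumn_cat /= addn0.
have [->|neq] := eqVneq i i'; first by lia.
have := IHi _ (ltnW lti'); have : i < i' by lia.
lia.
Qed.

Lemma offset_size : offset (size s) = sumn s + size s.
Proof. by rewrite /offset take_size. Qed.

(** The free position after the last path keeps all positions at most [n - 2]. *)
Lemma pf_colourable n : 4 < n -> sumn s + size s <= n ->
  full_colourable_on (pf_rel s) (cycle_rel n) [set: pf_vert s].
Proof.
move=> n_gt4; rewrite -offset_size => le_n.
pose phi x := offset (pf_comp x) + pf_pos x.
apply: (@position_colouring _ _ _ _ phi) => //; rewrite {}/phi.
  move=> x _; have := offset_lt (pf_comp_lt x) (leqnn _).
  by have := pf_pos_lt x; lia.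
move=> x y _ _; rewrite pf_relE.
have [ltx lty] := (pf_pos_lt x, pf_pos_lt y).
case: (ltngtP (pf_comp x) (pf_comp y)) => [lt|lt|->].
- by have := offset_lt lt (ltnW (pf_comp_lt y)); rewrite /adjn; lia.
- by have := offset_lt lt (ltnW (pf_comp_lt x)); rewrite /adjn; lia.
by rewrite /adjn; lia.
Qed.

(* The vertices of the component of the deleted vertex [v] are placed within a
   window of [r] positions, and those with [r <= g j] are identified with the
   isolated vertex forming component [0]; the later components then move [d]
   positions to the left. *)
Lemma pf_colourableD1 n v (g : nat -> nat) r d :
  4 < n -> sumn s + size s <= n + d ->
  d + (if r == 0 then 0 else r.+1) <= (nth 0 s (pf_comp v)).+1 ->
  (forall j j', j < nth 0 s (pf_comp v) -> j != pf_pos v ->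
     j' < nth 0 s (pf_comp v) -> j' != pf_pos v ->
     adjn j j' = [&& g j < r, g j' < r & adjn (g j) (g j')]) ->
  (forall j, j < nth 0 s (pf_comp v) -> j != pf_pos v -> r <= g j ->
     0 < pf_comp v /\ nth 0 s 0 = 1) ->
  full_colourable_on (pf_rel s) (cycle_rel n) [set~ v].
Proof.
move=> n_gt4; rewrite -offset_size => le_n le_d g_adj sh0.
pose phi x := if pf_comp x == pf_comp v then
    if g (pf_pos x) < r then offset (pf_comp v) + g (pf_pos x) else 0
  else if pf_comp x < pf_comp v then offset (pf_comp x) + pf_pos x
  else offset (pf_comp x) + pf_pos x - d.
apply: (@position_colouring _ _ _ _ phi) => //.
  move=> x; rewrite !inE pf_eqE /phi => neq.
  have ltx := pf_pos_lt x.
  have := offset_lt (pf_comp_lt v) (leqnn _).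
  have := offset_lt (pf_comp_lt x) (leqnn _).
  case: (ltngtP (pf_comp x) (pf_comp v)) neq => [lt _|lt _|eq /=].
  - by have := offset_lt lt (ltnW (pf_comp_lt v)); lia.
  - by lia.
  case: ifP => [lt_r _|_ _]; last by lia.
  by rewrite -eq in le_d *; move: lt_r le_d; case: (r =P 0); lia.
move=> x y; rewrite !inE !pf_eqE pf_relE.
wlog le_xy : x y / pf_comp x <= pf_comp y.
  move=> H xv yv.
  have [le|/ltnW le] := leqP (pf_comp x) (pf_comp y); first exact: H.
  by rewrite eq_sym /adjn orbC H // /adjn orbC.
(* Merged vertices go to position 0, whose only neighbour is position 1. A [K_1] in component 0
   before [v] pushes the window to positions from 2 on. *)
have sh_off j : j < nth 0 s (pf_comp v) -> j != pf_pos v -> r <= g j ->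
    [/\ 0 < pf_comp v, nth 0 s 0 = 1 & 2 <= offset (pf_comp v)].
  move=> ltj jv ge_r; have [v_gt0 s0] := sh0 j ltj jv ge_r; split=> //.
  by have := offset_lt v_gt0 (ltnW (pf_comp_lt v)); rewrite s0; lia.
move=> neqx neqy.
have [[ltx lty] ltv] := (pf_pos_lt x, pf_pos_lt y, pf_pos_lt v).
have [eq_xy|neq_xy] := eqVneq (pf_comp x) (pf_comp y).
  rewrite /phi eq_xy; case: (ltngtP (pf_comp y) (pf_comp v)) => [lt|lt|eq].
  - by rewrite /adjn; lia.
  - have := offset_lt lt (ltnW (pf_comp_lt y)); rewrite /adjn.
    by move: le_d; case: (r =P 0); lia.
  rewrite eq_xy eq in ltx; rewrite eq in lty.
  rewrite eq_xy eq eqxx /= in neqx; rewrite eq eqxx /= in neqy.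
  rewrite g_adj //; case: (ltnP (g (pf_pos x)) r); case: (ltnP (g (pf_pos y)) r);
    rewrite /= /adjn; try lia.
  + by move=> ge_r _; have [_ _] := sh_off _ lty neqy ge_r; lia.
  + by move=> _ ge_r; have [_ _] := sh_off _ ltx neqx ge_r; lia.
have {neq_xy le_xy}lt_xy : pf_comp x < pf_comp y by lia.
have offxy := offset_lt lt_xy (ltnW (pf_comp_lt y)).
rewrite /phi; case: (ltngtP (pf_comp x) (pf_comp v)) => [ltv_x|ltx_v|eq_x].
- have offxv := offset_lt ltv_x (ltnW (pf_comp_lt v)).
  case: (ltngtP (pf_comp y) (pf_comp v)) => [lt|lt|eq_y].
  + by rewrite /adjn; lia.
  + have := offset_lt lt (ltnW (pf_comp_lt y)); rewrite /adjn.
    by move: le_d; case: (r =P 0); lia.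
  case: ltnP => [lt_r|ge_r]; first by rewrite /adjn; lia.
  rewrite eq_y in lty; rewrite eq_y eqxx /= in neqy.
  have [v_gt0 s0 _] := sh_off _ lty neqy ge_r.
  have [x0|x_gt0] := posnP (pf_comp x).
    by move: ltx; rewrite x0 s0 /offset take0 /adjn /=; lia.
  by have := offset_lt x_gt0 (ltnW (pf_comp_lt x)); rewrite s0 /adjn; lia.
- have offvx := offset_lt ltx_v (ltnW (pf_comp_lt x)).
  have -> : (pf_comp y == pf_comp v) = false by lia.
  have -> : (pf_comp y < pf_comp v) = false by lia.
  by rewrite /adjn; move: le_d; case: (r =P 0); lia.
- rewrite eq_x in lt_xy offxy ltx; rewrite eq_x eqxx /= in neqx.
  have -> : (pf_comp y == pf_comp v) = false by lia.
  have -> : (pf_comp y < pf_comp v) = false by lia.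
  case: ltnP => [lt_r|ge_r].
    by rewrite /adjn; move: le_d; case: (r =P 0); lia.
  by have [_ _] := sh_off _ ltx neqx ge_r; rewrite /adjn; lia.
Qed.

End PathForest.

(** * Minimal linear forests *)

(** The forest has [sumn s - size s] edges, so the edge count of an embedding would give
    [sumn s + size s <= n]. *)
Lemma pf_not_colourable n s : 4 < n -> all (leq 1) s -> single_K1 s ->
  3 \notin s -> n < sumn s + size s ->
  ~ full_colourable_on (pf_rel s) (cycle_rel n) [set: pf_vert s].
Proof.
move=> n_gt4 s_gt0 s1 s3 lt_n; apply: not_colourable; first by lia.
  exact: pf_twin_free.
by rewrite cardsT card_pf_vert; have := degree_sum_pf s_gt0; lia.
Qed.

(* [p] is the order of the component, [j0] the deleted vertex and [nth 0 tab]
   the placement [g] of [pf_colourableD1]; an entry 9, being at least [r], marks a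
   vertex that joins the isolated one (or the deleted vertex). *)
Definition local_table (p j0 r : nat) (tab : seq nat) : bool :=
  all (fun j => all (fun j' => [|| j == j0, j' == j0 |
    adjn j j' == [&& nth 0 tab j < r, nth 0 tab j' < r
                   & adjn (nth 0 tab j) (nth 0 tab j')]])
    (iota 0 p)) (iota 0 p).

Lemma pf_colourable_table n s (v : pf_vert s) r d tab :
  4 < n -> sumn s + size s <= n + d ->
  d + (if r == 0 then 0 else r.+1) <= (nth 0 s (pf_comp v)).+1 ->
  local_table (nth 0 s (pf_comp v)) (pf_pos v) r tab ->
  (forall j, j < nth 0 s (pf_comp v) -> j != pf_pos v -> r <= nth 0 tab j ->
     0 < pf_comp v /\ nth 0 s 0 = 1) ->
  full_colourable_on (pf_rel s) (cycle_rel n) [set~ v].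
Proof.
move=> n_gt4 le_n le_d tabP sh0.
apply: (@pf_colourableD1 _ _ v (nth 0 tab) r d) => // j j' ltj jv ltj' jv'.
have inI k : k < nth 0 s (pf_comp v) -> k \in iota 0 (nth 0 s (pf_comp v)).
  by rewrite mem_iota.
have := allP (allP tabP _ (inI _ ltj)) _ (inI _ ltj').
by rewrite (negPf jv) (negPf jv') => /eqP.
Qed.

(** A deletion saves two positions in [P_2] and [P_4] and one in [P_6]. Vertices left isolated join
    the [K_1], and the ends of a remaining [P_3] are merged. *)
Lemma local_table_ex p j : p \in [:: 2; 4; 6] -> j < p ->
  exists r tab, local_table p j r tab /\
    (if p == 6 then 1 else 2) + (if r == 0 then 0 else r.+1) <= p.+1.
Proof.
rewrite !inE => /or3P [] /eqP ->.
- by case: j => [|[|//]] _; exists 0, [:: 0; 0].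
- case: j => [|[|[|[|//]]]] _; exists 2.
  + by exists [:: 9; 0; 1; 0].
  + by exists [:: 9; 9; 0; 1].
  + by exists [:: 0; 1; 9; 9].
  + by exists [:: 0; 1; 0; 9].
case: j => [|[|[|[|[|[|//]]]]]] _; exists 5.
- by exists [:: 9; 0; 1; 2; 3; 4].
- by exists [:: 9; 9; 0; 1; 2; 3].
- by exists [:: 0; 1; 9; 3; 4; 3].
- by exists [:: 0; 1; 0; 9; 3; 4].
- by exists [:: 0; 1; 2; 3; 9; 9].
- by exists [:: 0; 1; 2; 3; 4; 9].
Qed.

(** Here [d] is the excess of [sumn s + size s] over [n]. Each deletion must save [d] positions, and
    the tables save only one in a [P_6], whence the bound [2 - (6 \in t)]. The [K_1] stands first
    because merged vertices go to component 0. *)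
Lemma pf_K1_minimal n d t (s := 1 :: t) : 4 < n ->
  {subset t <= [:: 2; 4; 6]} -> 0 < d <= 2 - (6 \in t) ->
  sumn s + size s = n + d -> minimal_obstruction (pf_rel s) (cycle_rel n).
Proof.
move=> n_gt4 tP d_ok sizeE.
have t_nth i : 0 < i -> i < size s -> nth 0 s i \in t.
  by case: i => // i _ lti; apply: mem_nth.
have not_t k : k \notin [:: 2; 4; 6] -> k \notin t by apply: contra => /tP.
apply: minimalP => [|v].
  apply: pf_not_colourable => //.
  - by apply/allP => k; rewrite inE => /predU1P [->//|/tP]; rewrite !inE; lia.
  - have no1 i : i < size s -> nth 0 s i = 1 -> i = 0.
      move=> lti s1; apply/eqP; apply: contraNT (not_t 1 isT) => i_gt0.
      by rewrite -s1 t_nth // lt0n.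
    by move=> i i' lti lti' /(no1 _ lti) -> /(no1 _ lti') ->.
  - by rewrite inE negb_or not_t.
  - by rewrite sizeE; lia.
have ltv := pf_pos_lt v.
have [v0|v_gt0] := posnP (pf_comp v).
  (* Deleting the [K_1] leaves an empty window and frees its position and the gap after it. *)
  apply: (@pf_colourable_table _ _ v 0 d [::]) => //.
  - by rewrite sizeE.
  - by rewrite v0 /=; lia.
  - by move: ltv; rewrite v0 /=; case: (pf_pos v).
  - by move=> j; move: ltv; rewrite v0 /=; lia.
have vt := t_nth _ v_gt0 (pf_comp_lt v).
have [r [tab [tabP le_d]]] := local_table_ex (tP _ vt) ltv.
apply: (@pf_colourable_table _ _ v r d tab) => //; first by rewrite sizeE.
apply: leq_trans le_d; rewrite leq_add2r.
by case: eqP vt => [->|_] vt; move: d_ok; rewrite ?vt; case: (6 \in t); lia.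
Qed.

(** Deleting a vertex turns one [K_2] into a [K_1], saving one position, which is the whole
    excess. *)
Lemma pf_K2_minimal n m : 4 < n -> 3 * m = n + 1 ->
  minimal_obstruction (pf_rel (nseq m 2)) (cycle_rel n).
Proof.
move=> n_gt4 sizeE.
have nthE i : i < m -> nth 0 (nseq m 2) i = 2 by rewrite nth_nseq => ->.
have notin k : k != 2 -> k \notin nseq m 2.
  by rewrite mem_nseq => /negPf ->; rewrite andbF.
apply: minimalP => [|v].
  apply: pf_not_colourable => //.
  - by apply/allP => k /nseqP [->].
  - by move=> i i'; rewrite size_nseq => lti _; rewrite nthE.
  - exact: notin.
  - by rewrite sumn_nseq size_nseq; lia.
have := pf_comp_lt v; rewrite {1}size_nseq => ltv; have := pf_pos_lt v.
have := nthE _ ltv => v2; rewrite v2 => ltp.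
apply: (@pf_colourable_table _ _ v 1 1 [:: 0; 0]) => //.
- by rewrite sumn_nseq size_nseq; lia.
- by rewrite v2.
- by rewrite v2; move: ltp; case: (pf_pos v) => [|[|]].
- by rewrite v2; case=> [|[|]].
Qed.

Lemma sorted_blocks s : sorted leq s -> {subset s <= [:: 1; 2; 4; 6]} ->
  exists c1 c2 c4 c6, s = nseq c1 1 ++ nseq c2 2 ++ nseq c4 4 ++ nseq c6 6.
Proof.
elim: s => [|a s IHs] s_sorted sP; first by exists 0, 0, 0, 0.
have [] := IHs (path_sorted s_sorted).
  by move=> k ks; apply: sP; rewrite inE ks orbT.
move=> c1 [c2 [c4 [c6 sE]]].
have le_a k : k \in s -> a <= k.
  by move/(allP (order_path_min leq_trans s_sorted)).
have [in1 in2 in4] :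
    [/\ 0 < c1 -> a <= 1, 0 < c2 -> a <= 2 & 0 < c4 -> a <= 4].
  by split=> c_gt0; apply: le_a; rewrite sE !mem_cat !mem_nseq c_gt0 eqxx ?orbT.
have := sP a (mem_head _ _); rewrite !inE => /or4P [] /eqP aE.
- by exists c1.+1, c2, c4, c6; rewrite sE aE.
- have c1_0 : c1 = 0 by lia.
  by exists 0, c2.+1, c4, c6; rewrite sE aE c1_0.
- have [c1_0 c2_0] : c1 = 0 /\ c2 = 0 by lia.
  by exists 0, 0, c4.+1, c6; rewrite sE aE c1_0 c2_0.
- have [c1_0 [c2_0 c4_0]] : c1 = 0 /\ c2 = 0 /\ c4 = 0 by lia.
  by exists 0, 0, 0, c6.+1; rewrite sE aE c1_0 c2_0 c4_0.
Qed.

Section Minimal.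

Variables (n : nat) (s : seq nat).
Hypotheses (n_gt4 : 4 < n) (s_gt0 : all (leq 1) s).
Hypothesis min_s : minimal_obstruction (pf_rel s) (cycle_rel n).

Let weight := sumn s + size s.

Lemma pf_minimal_weight : n < weight.
Proof.
rewrite ltnNge; apply/negP => le_n; case: min_s => ncol _.
exact/ncol/pf_colourable.
Qed.

Lemma pf_minimal_K1 : single_K1 s.
Proof.
move=> i i' lti lti' si si'; apply/eqP/negPn/negP => neq.
have [||x [cx px]] := @pf_ex s i 0; rewrite ?si //.
have [||y [cy py]] := @pf_ex s i' 0; rewrite ?si' //.
have [|z _] := minimal_twin_free (@pf_rel_sym s) min_s (in_setT x) (in_setT y).
  by rewrite pf_eqE cx cy (negPf neq).
have isol k : nth 0 s k = 1 -> (k == pf_comp z) && adjn 0 (pf_pos z) = false.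
  have := pf_pos_lt z; case: (k =P pf_comp z) => //= <- ltz sk.
  by rewrite /adjn; lia.
by rewrite !pf_relE cx cy px py !isol // eqxx.
Qed.

Lemma pf_minimal_3 : 3 \notin s.
Proof.
apply/negP => /(nthP 0) [i lti si].
have [||x [cx px]] := @pf_ex s i 0; rewrite ?si //.
have [||y [cy py]] := @pf_ex s i 2; rewrite ?si //.
have [|z _] := minimal_twin_free (@pf_rel_sym s) min_s (in_setT x) (in_setT y).
  by rewrite pf_eqE cx cy px py andbF.
have := pf_pos_lt z; rewrite !pf_relE cx cy px py.
by case: (i =P pf_comp z) => //= <-; rewrite si /adjn; lia.
Qed.

(** This is [minimal_degree_sum] with the degree sum [2 * sumn s - 2 * size s]; the two added
    booleans make up the degree of the deleted vertex, and the side conditions keep the rest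
    twin-free. *)
Lemma pf_minimal_delete i j (p := nth 0 s i) : i < size s -> j < p ->
  j != 3 -> p - j.+1 != 3 -> ((j == 1) || (p - j.+1 == 1)) ==> (1 \notin s) ->
  weight + (0 < j) + (j.+1 < p) <= n + 2.
Proof.
rewrite {}/p => lti ltj j3 r3 lr1; have [v [cv pv]] := pf_ex lti ltj.
have n_gt2 : 2 < n by lia.
have := @minimal_degree_sum _ _ _ v n_gt2 (@pf_rel_sym s) (@pf_rel_irr s) min_s.
rewrite degree_pf cv pv card_pf_vert => H.
have {H} := H (pf_twin_freeD1 pf_minimal_K1 pf_minimal_3 _ _ _).
rewrite cv pv => /(_ j3 r3 lr1); have := degree_sum_pf s_gt0.
by rewrite /weight; lia.
Qed.

(** In a path of order 5 or at least 7, deleting position 2 leaves orders 2 and [p - 3], neither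
    being 1 or 3. The deleted vertex has degree 2, so [weight] would be at most [n]. *)
Lemma pf_minimal_sizes : {subset s <= [:: 1; 2; 4; 6]}.
Proof.
move=> p ps; have := ps => /(nthP 0) [i lti si]; have lt_n := pf_minimal_weight.
have p3 : p != 3 by apply: contraNneq pf_minimal_3 => <-.
have p_gt0 := allP s_gt0 _ ps.
have := @pf_minimal_delete i 2 lti; rewrite si !inE.
have [|p5] := boolP ((p == 5) || (6 < p)); last by lia.
case/orP => [/eqP ->/(_ isT isT isT isT)|p_gt6]; first by lia.
have lt2p : 2 < p by lia.
have r3 : p - 3 != 3 by lia.
have -> : (2 == 1) || (p - 3 == 1) = false by lia.
have -> : 3 < p by lia.
by move/(_ lt2p isT r3 isT) => le_n; lia.
Qed.

(** Deleting position 1 of a [P_4] or [P_6] creates the only isolated vertex, and degree 2 forces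
    [weight] down to [n], a contradiction. Deleting an end of a [K_2] then gives at most [n + 1]. *)
Lemma pf_minimal_no_K1 : 1 \notin s ->
  s = nseq (size s) 2 /\ 3 * size s = n + 1.
Proof.
move=> s1; have lt_n := pf_minimal_weight.
have all2 : all (pred1 2) s.
  apply/allP => p ps; have := ps => /(nthP 0) [i lti si].
  have := pf_minimal_sizes ps; have := @pf_minimal_delete i 1 lti.
  rewrite si s1 !inE => H /or4P [] /eqP pE; rewrite pE // in H ps *.
  - by rewrite ps in s1.
  - by have := H isT isT isT isT; lia.
  - by have := H isT isT isT isT; lia.
have sE : s = nseq (size s) 2 by apply/all_pred1P.
split=> //; move: (lt_n); rewrite /weight {1}sE sumn_nseq => lt_n'.
have s_gt : 0 < size s by lia.
have s0 : nth 0 s 0 = 2 by rewrite sE nth_nseq s_gt.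
have := @pf_minimal_delete 0 0 s_gt; rewrite s0 s1 => /(_ isT isT isT isT).
by rewrite /weight {1}sE sumn_nseq; lia.
Qed.

End Minimal.

Lemma graph_iso_refl (T : finType) (e : rel T) : graph_iso e e.
Proof. by exists id; split=> //; exists id. Qed.

Lemma pf_minimal_family n s : 4 < n -> all (leq 1) s -> sorted leq s ->
  minimal_obstruction (pf_rel s) (cycle_rel n) -> obs_cycle_family n (pf_rel s).
Proof.
move=> n_gt4 s_gt0 s_sorted min_s.
have iso_s := graph_iso_refl (pf_rel s).
have lt_n := pf_minimal_weight n_gt4 min_s.
have [s1|s1] := boolP (1 \in s); last first.
  have [sE m_n] := pf_minimal_no_K1 n_gt4 s_gt0 min_s s1.
  by right; left; exists (size s); rewrite -sE.
have [c1 [c2 [c4 [c6 sE]]]] :=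
  sorted_blocks s_sorted (pf_minimal_sizes n_gt4 s_gt0 min_s).
have c1E : c1 = 1.
  have : 0 < c1.
    by move: s1; rewrite sE !mem_cat !mem_nseq !andbF !orbF => /andP [].
  case: c1 sE => [//|[//|c]] sE _.
  have := pf_minimal_K1 n_gt4 s_gt0 min_s (i := 0) (i' := 1); rewrite sE => H.
  by have := H isT isT erefl erefl.
rewrite c1E /= in sE.
have weightE : sumn s + size s = 2 + 3 * c2 + 5 * c4 + 7 * c6.
  by rewrite sE /= !sumn_cat !size_cat !sumn_nseq !size_nseq; lia.
have del := pf_minimal_delete n_gt4 s_gt0 min_s.
(* Deleting the [K_1], a vertex of degree 0, bounds the excess by 2. *)
have le_n : sumn s + size s <= n + 2.
  have s_gt : 0 < size s by rewrite sE.
  have s0 : nth 0 s 0 = 1 by rewrite sE.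
  by have := del 0 0 s_gt; rewrite s0 => /(_ isT isT isT isT); lia.
have [c6_0|c6_gt0] := posnP c6.
  rewrite c6_0 cats0 in sE; rewrite c6_0 in weightE.
  (* Without [P_6], excess 1 is [LF_3] with [m_6 = 0] and excess 2 is [LF_2]. *)
  have [le_n1|gt_n1] := leqP (sumn s + size s) n.+1.
    right; right; right; left; exists c2, c4, 0; split; first by lia.
    by rewrite cats0 -sE.
  right; right; left; exists c2, c4; split; first by lia.
  by rewrite -sE.
have /(nthP 0) [i lti si] : 6 \in s.
  by rewrite sE inE !mem_cat !mem_nseq c6_gt0 !orbT.
(* An end of a [P_6] has degree 1 and its deletion leaves a [P_5], so the excess is 1. *)
have := del i 0 lti; rewrite si => /(_ isT isT isT isT) le_n1.
right; right; right; left; exists c2, c4, c6; split; first by lia.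
by rewrite -sE.
Qed.

(** * Small induced subgraphs of a minimal obstruction *)

(** Only one vertex of [C_5] is adjacent to neither end of a given edge. This serves [n = 5], where
    [C_5] is not an obstruction. *)
Lemma no_2K2_in_C5 (x y z t : 'I_5) :
  cycle_rel 5 x y -> cycle_rel 5 z t ->
  [|| cycle_rel 5 x z, cycle_rel 5 x t, cycle_rel 5 y z | cycle_rel 5 y t].
Proof.
rewrite !cycle_relE //.
case: x => [[|[|[|[|[|//]]]]] ?]; case: y => [[|[|[|[|[|//]]]]] ?] //= _;
by case: z => [[|[|[|[|[|//]]]]] ?] //; case: t => [[|[|[|[|[|//]]]]] ?].
Qed.

Section MinimalGraph.

Variables (T : finType) (e : rel T) (n : nat).
Hypotheses (n_gt4 : 4 < n) (e_sym : symmetric e) (e_irr : irreflexive e).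
Hypothesis min_e : minimal_obstruction e (cycle_rel n).

Let twinP x y : x != y -> exists z, e x z != e y z.
Proof.
case/(minimal_twin_free e_sym min_e (in_setT x) (in_setT y)) => z _.
by exists z.
Qed.

Lemma cycle_family m (g : 'I_m -> T) : (m == 3) || (4 < m < n) ->
  (forall i j, cycle_rel m i j = e (g i) (g j)) -> obs_cycle_family n e.
Proof.
move=> m_ok eE; left; exists m; split; first by lia.
apply: minimal_embedding_iso min_e (cycle_not_colourable n_gt4 m_ok) _ eE.
by apply: cycle_twin_free; lia.
Qed.

Lemma seq_rel_embedding m (h : rel 'I_m) (r : rel nat) (t : seq T) (x0 : T) :
  (forall i j : 'I_m, h i j = r i j) -> symmetric r -> irreflexive r ->
  (forall j i, j < m -> i < j -> r i j = e (nth x0 t i) (nth x0 t j)) ->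
  forall i j : 'I_m, h i j = e (nth x0 t i) (nth x0 t j).
Proof.
move=> hE r_sym r_irr rE i j; rewrite hE.
have [lt|lt|->] := ltngtP i j; last by rewrite r_irr e_irr.
  by apply: rE; rewrite ?ltn_ord.
by rewrite r_sym e_sym; apply: rE; rewrite ?ltn_ord.
Qed.

Lemma triangle_family a b c :
  e a b -> e b c -> e a c -> obs_cycle_family n e.
Proof.
move=> ab bc ac; pose r i j := (i < 3) && (j < 3) && (i != j).
apply: (@cycle_family 3 (fun i => nth a [:: a; b; c] i)) => //.
apply: (@seq_rel_embedding _ _ r).
- by move=> [[|[|[|//]]] ?] [[|[|[|//]]] ?].
- by move=> i j; rewrite /r; lia.
- by move=> i; rewrite /r eqxx andbF.
by case=> [|[|[|//]]] [|[|[|//]]].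
Qed.

Lemma six_embedding (l : seq (nat * nat)) (t : seq T) x0 :
  all (fun i => i.1 != i.2) l ->
  (forall j i, j < 6 -> i < j ->
     ((i, j) \in l) || ((j, i) \in l) = e (nth x0 t i) (nth x0 t j)) ->
  forall i j : 'I_6, edges_rel l i j = e (nth x0 t i) (nth x0 t j).
Proof.
move=> irr; pose r i j := ((i, j) \in l) || ((j, i) \in l).
apply: (@seq_rel_embedding _ _ r); rewrite /r.
- by [].
- by move=> i j; rewrite orbC.
- by move=> i; rewrite orbb; apply/negP => /(allP irr) /=; rewrite eqxx.
Qed.

Lemma six_iso (l : seq (nat * nat)) (t : seq T) x0 :
  twin_free_seq l (iota 0 6) ->
  [&& (0, 1) \in l, (1, 2) \in l & (1, 4) \in l] ->
  all (fun i => i.1 != i.2) l ->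
  (forall j i, j < 6 -> i < j ->
     ((i, j) \in l) || ((j, i) \in l) = e (nth x0 t i) (nth x0 t j)) ->
  graph_iso e (edges_rel l).
Proof.
move=> tf l_nbrs irr eE.
apply: minimal_embedding_iso min_e _ _ (six_embedding irr eE).
  exact: edges_not_colourable.
exact: edges_twin_freeT.
Qed.

(** Vertex [1] has degree 3 in all three graphs. With 6 edges the bound reads [26 <= 2 * n + 12];
    the next two graphs have 7 and 5 edges, replacing 12 by 14 and 10. *)
Lemma graph_A_family : graph_iso e graph_A -> obs_cycle_family n e.
Proof.
move=> isoA; do 5 right; left; split=> //.
have min_A := minimal_iso (graph_iso_sym isoA) min_e.
by have := edges_minimal_bound n_gt4 _ _ min_A => /(_ isT isT) /=; lia.
Qed.

Lemma graph_B_family : graph_iso e graph_B -> obs_cycle_family n e.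
Proof.
move=> isoB; do 4 right; left; split=> //.
have min_B := minimal_iso (graph_iso_sym isoB) min_e.
by have := edges_minimal_bound n_gt4 _ _ min_B => /(_ isT isT) /=; lia.
Qed.

Lemma graph_E_family : graph_iso e graph_E -> obs_cycle_family n e.
Proof.
move=> isoE; do 6 right; split=> //.
have min_E := minimal_iso (graph_iso_sym isoE) min_e.
by have := edges_minimal_bound n_gt4 _ _ min_E => /(_ isT isT) /=; lia.
Qed.

Hypothesis no_triangle : forall a b c, e a b -> e b c -> e a c -> False.

Let triF a b c : e a b -> e b c -> e a c = false.
Proof. by move=> ab bc; apply/negP => ac; apply: no_triangle ab bc ac. Qed.

Lemma square_family a b c d : a != c -> b != d ->
  e a b -> e b c -> e c d -> e d a -> obs_cycle_family n e.
Proof.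
move=> neq_ac neq_bd ab bc cd da.
(* Opposite corners are not twins; after reflecting the square, [z] is adjacent to [a] and not to
   [c]. *)
have [z] := twinP neq_ac; wlog za : a c neq_ac ab bc cd da / e a z && ~~ e c z.
  move=> H ez; have [az|naz] := boolP (e a z && ~~ e c z); first exact: (H a c).
  have [cb [ba [ad dc]]] : e c b /\ e b a /\ e a d /\ e d c.
    by rewrite (e_sym c b) (e_sym b a) (e_sym a d) (e_sym d c).
  apply: (H c a) => //; rewrite 1?eq_sym //.
  by move: ez naz; case: (e a z); case: (e c z).
move=> _; case/andP: za => az /negPf ncz.
have [w] := twinP neq_bd; wlog wb : b d neq_bd ab bc cd da / e b w && ~~ e d w.
  move=> H ew; have [bw|nbw] := boolP (e b w && ~~ e d w); first exact: (H b d).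
  have [dc [cb [ba ad]]] : e d c /\ e c b /\ e b a /\ e a d.
    by rewrite (e_sym d c) (e_sym c b) (e_sym b a) (e_sym a d).
  apply: (H d b) => //; rewrite 1?eq_sym //.
  by move: ew nbw; case: (e b w); case: (e d w).
move=> _; case/andP: wb => bw /negPf ndw.
have za : e z a by rewrite e_sym.
have ad : e a d by rewrite e_sym.
have dc : e d c by rewrite e_sym.
have cb : e c b by rewrite e_sym.
have zd := triF za ad; have zb := triF za ab.
have zc : e z c = false by rewrite e_sym.
have ac := triF ab bc; have aw := triF ab bw; have cw := triF cb bw.
have db := triF da ab.
(* The path [z, a, d, c, b, w] with the chord [ab] is [graph_A]; an edge [zw] makes it [graph_B]. *)
have [zw|/negPf nzw] := boolP (e z w).
  apply/graph_B_family/(six_iso (t := [:: z; a; d; c; b; w]) (x0 := z)) => //.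
  by case=> [|[|[|[|[|[|//]]]]]] [|[|[|[|[|[|//]]]]]] //= _ _;
    rewrite ?za ?ad ?dc ?cb ?bw ?ab ?zw ?zd ?zc ?zb ?ac ?aw ?db ?ndw ?cw.
apply/graph_A_family/(six_iso (t := [:: z; a; d; c; b; w]) (x0 := z)) => //.
by case=> [|[|[|[|[|[|//]]]]]] [|[|[|[|[|[|//]]]]]] //= _ _;
  rewrite ?za ?ad ?dc ?cb ?bw ?ab ?nzw ?zd ?zc ?zb ?ac ?aw ?db ?ndw ?cw.
Qed.

Hypothesis no_square : forall a b c d, a != c -> b != d ->
  e a b -> e b c -> e c d -> e d a -> False.

(** The vertices [v, a, a', b', b] induce a [C_5], an obstruction when [n > 5]. For [n = 5], the
    edges [vc] and [a'b'] form an induced [2K_2] avoiding [a], so the graph without [a] has no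
    colouring. *)
Lemma pentagon_family v a a' b' b c :
  e v a -> e v b -> e v c -> e a a' -> e b b' -> e a' b' ->
  a != b -> a != c -> b != c -> a' != v -> b' != v ->
  obs_cycle_family n e.
Proof.
move=> va vb vc aa' bb' a'b' neq_ab neq_ac neq_bc a'v b'v.
have av : e a v by rewrite e_sym.
have a'a : e a' a by rewrite e_sym.
have b'b : e b' b by rewrite e_sym.
have va' := triF va aa'; have vb' := triF vb bb'.
have ab := triF av vb; have ab' := triF aa' a'b'.
have a'b := triF a'b' b'b.
have [n_gt5|] := ltnP 5 n.
  apply: (@cycle_family 5 (fun i => nth v [:: v; a; a'; b'; b] i)).
    by rewrite n_gt5.
  apply: (@seq_rel_embedding _ _
    (fun i j => [|| adjn i j, (i == 0) && (j == 4) | (j == 0) && (i == 4)])).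
  - by move=> i j; rewrite cycle_relE.
  - move=> i j; congr (_ || _); first exact: adjn_sym.
    by rewrite orbC.
  - by move=> i; rewrite adjn_irr; case: i => [|[|[|[|[]]]]].
  by case=> [|[|[|[|[|//]]]]] [|[|[|[|[|//]]]]] //= _ _;
    rewrite ?va ?vb ?aa' ?a'b' ?b'b ?va' ?vb' ?ab ?ab' ?a'b.
move=> le_n5; have n5 : n = 5 by apply/eqP; rewrite eqn_leq le_n5.
have cv : e c v by rewrite e_sym.
have ca' : e c a' = false.
  apply/negP => ca'; have a'c : e a' c by rewrite e_sym.
  by apply: (@no_square v a a' c) => //; rewrite eq_sym.
have cb' : e c b' = false.
  apply/negP => cb'; have b'c : e b' c by rewrite e_sym.
  by apply: (@no_square v b b' c) => //; rewrite eq_sym.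
have := minimal_colourable a min_e; rewrite n5 => -[f hom_f].
have fE x y : x != a -> y != a -> e x y = cycle_rel 5 (f x) (f y).
  by move=> xa ya; rewrite hom_f // !inE.
have v_neq : v != a by apply: contraTneq va => ->; rewrite e_irr.
have c_neq : c != a by rewrite eq_sym.
have a'_neq : a' != a by apply: contraTneq aa' => ->; rewrite e_irr.
have b'_neq : b' != a by apply: contraTneq va => <-; rewrite vb'.
have := @no_2K2_in_C5 (f v) (f c) (f a') (f b').
by rewrite -!fE // vc a'b' va' vb' ca' cb' => /(_ isT isT).
Qed.

(** [graph_E] is the spider centred at vertex [1] with legs of lengths 2, 2 and 1; an edge [a'b']
    closes a pentagon instead. *)
Lemma spider_family v a b c a' b' :
  e v a -> e v b -> e v c -> e a a' -> e b b' ->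
  a != b -> a != c -> b != c -> a' != v -> b' != v ->
  obs_cycle_family n e.
Proof.
move=> va vb vc aa' bb' neq_ab neq_ac neq_bc a'v b'v.
have [a'b'|/negPf na'b'] := boolP (e a' b').
  exact: pentagon_family va vb vc aa' bb' a'b' _ _ _ _ _.
have [av [bv cv]] : e a v /\ e b v /\ e c v by rewrite !(e_sym _ v).
have [a'a b'b] : e a' a /\ e b' b by rewrite (e_sym a') (e_sym b').
have va' := triF va aa'; have vb' := triF vb bb'.
have ab := triF av vb; have ac := triF av vc; have bc := triF bv vc.
(* Such an edge would close a 4-cycle through [v]. *)
have far x y x' :
    e v x -> e v y -> x != y -> e x x' -> x' != v -> e y x' = false.
  move=> vx vy neq_xy xx' x'v; apply/negP => yx'.
  apply: (@no_square v x x' y) => //; rewrite 1?eq_sym // e_sym //.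
have ab' : e a b' = false by apply: (far b); rewrite // eq_sym.
have cb' : e c b' = false by apply: (far b); rewrite // eq_sym.
have ba' : e b a' = false by apply: (far a).
have ca' : e c a' = false by apply: (far a).
have a'v_f : e a' v = false by rewrite e_sym.
apply/graph_E_family/(six_iso (t := [:: a; v; b; b'; c; a']) (x0 := v)) => //.
by case=> [|[|[|[|[|[|//]]]]]] [|[|[|[|[|[|//]]]]]] //= _ _;
  rewrite ?av ?vb ?vc ?bb' ?aa' ?ab ?ab' ?ac ?vb' ?bc ?va' ?ba' ?cb' ?ca'
    ?(e_sym b' c) ?(e_sym b' a') ?cb' ?na'b'.
Qed.

(** Two neighbours of [v] without further neighbours would be twins, so at least two of the three
    extend to legs of length 2. *)
Lemma degree3_family v a b c : e v a -> e v b -> e v c ->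
  a != b -> a != c -> b != c -> obs_cycle_family n e.
Proof.
move=> va vb vc neq_ab neq_ac neq_bc.
pose leg x := [exists y, (y != v) && e x y].
have legs x y : e v x -> e v y -> x != y -> leg x || leg y.
  move=> vx vy /twinP [z ez].
  have zv : z != v by apply: contraNneq ez => ->; rewrite !(e_sym _ v) vx vy.
  have [xz|nxz] := boolP (e x z).
    by apply/orP; left; apply/existsP; exists z; rewrite zv.
  apply/orP; right; apply/existsP; exists z; rewrite zv.
  by move: ez; rewrite (negPf nxz); case: (e y z).
have two x y w : e v x -> e v y -> e v w -> x != y -> x != w -> y != w ->
    leg x -> leg y -> obs_cycle_family n e.
  move=> vx vy vw neq_xy neq_xw neq_yw /existsP [x' /andP [x'v xx']].
  case/existsP => y' /andP [y'v yy'].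
  exact: spider_family vx vy vw xx' yy' _ _ _ _ _.
have [neq_ca neq_cb] : c != a /\ c != b by rewrite !(eq_sym c).
have [la|nla] := boolP (leg a); have [lb|nlb] := boolP (leg b).
- exact: (two a b c).
- have := legs _ _ vb vc neq_bc; rewrite (negPf nlb) => lc.
  exact: (two a c b).
- have := legs _ _ va vc neq_ac; rewrite (negPf nla) => lc.
  by apply: (two b c a); rewrite // eq_sym.
- by have := legs _ _ va vb neq_ab; rewrite (negPf nla) (negPf nlb).
Qed.

End MinimalGraph.

(** * Graphs of maximum degree two *)

Section Degree2.

Variables (T : finType) (e : rel T).
Hypotheses (e_sym : symmetric e) (e_irr : irreflexive e).
Hypothesis deg2 : forall v a b c, e v a -> e v b -> e v c ->
  a != b -> a != c -> b != c -> False.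

Lemma third_nbr v a b c :
  e v a -> e v b -> a != b -> e v c -> (c == a) || (c == b).
Proof.
move=> va vb neq_ab vc; apply/negPn/negP; rewrite negb_or => /andP [ca cb].
by apply: (deg2 va vb vc); rewrite // eq_sym.
Qed.

Lemma degree_le2 v : degree e v <= 2.
Proof.
rewrite degreeE leqNgt; apply/negP.
case/card_gt2P => a [b [c [[va vb vc] [ab bc ca]]]].
by rewrite !inE in va vb vc; apply: (deg2 va vb vc); rewrite // eq_sym.
Qed.

Section Cycle.

Variables (m : nat) (g : 'I_m -> T).
Hypotheses (m_gt2 : 2 < m) (g_inj : injective g).
Hypothesis gE : forall i j, cycle_rel m i j = e (g i) (g j).

Lemma cycle_two_nbrs i :
  exists a b, [/\ a != b, e (g i) (g a) & e (g i) (g b)].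
Proof.
exists (ordS i), (ord_pred i); rewrite -!gE !cycle_rel_ordS ord_predK !eqxx orbT.
split=> //; rewrite -(inj_eq val_inj) [val (ordS i)]val_ordS [val _]val_ord_pred.
by have := ltn_ord i; case: (i.+1 =P m); case: (i =P 0 :> nat); lia.
Qed.

Lemma cycle_closed i y : e (g i) y -> exists j, y = g j.
Proof.
have [a [b [neq_ab ia ib]]] := cycle_two_nbrs i => iy.
have neq_g : g a != g b by rewrite (inj_eq g_inj).
have /orP [/eqP ->|/eqP ->] := third_nbr ia ib neq_g iy; first by exists a.
by exists b.
Qed.

(** The witness is the other cycle neighbour of [x], or else the other one of [y]; if [x] were
    adjacent to both and to the deleted vertex, it would have three neighbours. *)
Lemma cycle_twin_freeD1 i : twin_free e [set: T] -> twin_free e [set~ g i].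
Proof.
move=> tf x y xv yv neq; have [z _ ez] := tf x y (in_setT _) (in_setT _) neq.
set v := g i in xv yv *.
have [zv|zv] := eqVneq z v; last by exists z; rewrite // !inE.
rewrite {z}zv in ez.
wlog xz : x y xv yv neq ez / e x v && ~~ e y v.
  move=> H; have [/H|nxz] := boolP (e x v && ~~ e y v).
    exact.
  have [|||z zv ez'] := H y x yv xv; last by exists z; rewrite // eq_sym.
  - by rewrite eq_sym.
  - by rewrite eq_sym.
  - by move: ez nxz; case: (e x v); case: (e y v).
case/andP: xz => xv_e nyv.
have [j xE] : exists j, x = g j by apply: (@cycle_closed i); rewrite e_sym.
have other k w : exists2 l, e (g k) (g l) & g l != w.
  have [a [b [neq_ab ka kb]]] := cycle_two_nbrs k.
  have [aw|aw] := eqVneq (g a) w; last by exists a.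
  by exists b; rewrite // -aw (inj_eq g_inj) eq_sym.
have [k jk kv] := other j v; rewrite -xE in jk.
have [yk|nyk] := boolP (e y (g k)); last first.
  by exists (g k); rewrite ?inE // jk (negPf nyk).
have [l yE] : exists l, y = g l by apply: (@cycle_closed k); rewrite e_sym.
have [h lh hk] := other l (g k); rewrite -yE in lh.
have hv : g h != v by apply: contraNneq nyv => <-.
exists (g h); first by rewrite !inE.
rewrite lh; apply/negP => /eqP xh.
have := third_nbr xv_e jk _ xh; rewrite (negPf hk) (negPf hv) eq_sym kv.
by move=> /(_ isT).
Qed.

(** Counting gives [m <= #|T| <= n]. For [m = 4] opposite vertices are twins, any other [m < n]
    makes the cycle the whole graph, and for [m = n] the graph is the colourable [C_n]. *)
Lemma cycle_component_family n : 4 < n ->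
  minimal_obstruction e (cycle_rel n) -> obs_cycle_family n e.
Proof.
move=> n_gt4 min_e; have n_gt2 : 2 < n by apply: leq_trans n_gt4.
have tf := minimal_twin_free e_sym min_e.
have m_gt0 : 0 < m by apply: leq_trans m_gt2.
pose v := Ordinal m_gt0.
have le_mT : m <= #|T|.
  by have := max_card (mem (codom g)); rewrite card_codom ?card_ord.
have le_Tn : #|T| <= n.
  have H := minimal_degree_sum n_gt2 e_sym e_irr min_e (@cycle_twin_freeD1 v tf).
  have deg_v : 1 < degree e (g v).
    have [a [b [neq_ab va vb]]] := cycle_two_nbrs v.
    rewrite degreeE; apply/card_gt1P; exists (g a), (g b).
    by rewrite !inE (inj_eq g_inj).
  have : degree_sum e [set: T] <= 2 * #|T|.
    rewrite degree_sumT mulnC -sum_nat_const; apply: leq_sum => x _.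
    exact: degree_le2.
  by lia.
have [m4|m4] := eqVneq m 4.
  suff: False by [].
  have lt4 k : k < 4 -> k < m by rewrite m4.
  pose o k (lt : k < 4) := Ordinal (lt4 k lt).
  have [|z _] := tf (g (@o 0 isT)) (g (@o 2 isT)) (in_setT _) (in_setT _).
    by rewrite (inj_eq g_inj).
  have adj a b la lb : e (g (@o a la)) (g (@o b lb)) =
      [|| adjn a b, (a == 0) && (b == 3) | (b == 0) && (a == 3)].
    by rewrite -gE cycle_relE //= m4.
  have nbrs a la : (a == 0) || (a == 2) ->
      e (g (@o a la)) z = (z == g (@o 1 isT)) || (z == g (@o 3 isT)).
    move=> a02; have e1 : e (g (@o a la)) (g (@o 1 isT)).
      by rewrite adj; case/orP: a02 => /eqP ->.
    have e3 : e (g (@o a la)) (g (@o 3 isT)).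
      by rewrite adj; case/orP: a02 => /eqP ->.
    apply/idP/idP => [|/orP [] /eqP -> //]; apply: third_nbr e1 e3 _.
    by rewrite (inj_eq g_inj).
  by rewrite !nbrs // eqxx.
have [lt_mn|le_nm] := ltnP m n.
  by apply: (cycle_family n_gt4 min_e _ gE); lia.
case: min_e => ncol _; case: ncol.
have eq_mn : m = n by apply/eqP; rewrite eqn_leq le_nm (leq_trans le_mT le_Tn).
have [|f gK fK] := @inj_card_bij _ _ g g_inj.
  by rewrite card_ord eq_mn.
by rewrite -eq_mn; exists f => x y _ _; rewrite gE !fK.
Qed.

End Cycle.

End Degree2.

(** * Decomposition into paths *)

Section Decomposition.

Variables (T : finType) (e : rel T).
Hypotheses (e_sym : symmetric e) (e_irr : irreflexive e).

Definition path_component (p : seq T) : Prop :=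
  uniq p /\ forall x y, x \in p ->
    e x y = (y \in p) && adjn (index x p) (index y p).

Section PathDecomposition.

Hypothesis deg2 : forall v a b c, e v a -> e v b -> e v c ->
  a != b -> a != c -> b != c -> False.
Hypothesis no_cycle : forall m (g : 'I_m -> T), 2 < m -> injective g ->
  (forall i j, cycle_rel m i j = e (g i) (g j)) -> False.

(** Take a longest duplicate-free path in [S]: a new neighbour of an end would extend it. *)
Lemma maximal_path (S : {set T}) x : x \in S ->
  exists h t, let p := h :: t in
    [/\ uniq p, path e h t, {subset p <= S} &
      forall y, y \in S -> e h y || e (last h t) y -> y \in p].
Proof.
move=> xS; pose ok (p : seq T) := [&& uniq p, sorted e p & all (mem S) p].
pose P k := [exists p : k.-tuple T, ok p].
have P1 : exists k, P k.
  by exists 1; apply/existsP; exists [tuple x]; rewrite /ok /= xS.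
have P_le k : P k -> k <= #|T|.
  case/existsP => p /and3P [up _ _]; rewrite -(size_tuple p) -(card_uniqP up).
  exact: max_card.
case: (ex_maxnP P1 P_le) => k /existsP [p /and3P [up sp Sp]] max_k.
have longer q : size q = k.+1 -> ok q -> False.
  move=> sq okq; have := max_k k.+1; rewrite ltnn => H.
  have : P k.+1.
    by apply/existsP; exists (tcast sq (in_tuple q)); rewrite val_tcast.
  by move/H.
have k_gt0 : 0 < k.
  by apply: max_k; apply/existsP; exists [tuple x]; rewrite /ok /= xS.
case: (tval p) (size_tuple p) up sp Sp => [sp|h t sizep up sp Sp].
  by rewrite -sp in k_gt0.
exists h, t; split=> //; first exact/allP.
move=> y yS hy; apply/negPn/negP => yp; case/orP: hy => hy.
  apply: (longer (y :: h :: t)); first by rewrite -sizep.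
  by rewrite /ok; apply/and3P; split; rewrite /= ?yS // ?(e_sym y) ?hy //;
    apply/andP; split.
apply: (longer (rcons (h :: t) y)); first by rewrite size_rcons sizep.
rewrite /ok rcons_uniq yp up all_rcons Sp andbT /= yS rcons_path hy !andbT.
exact: sp.
Qed.

(** A longest path is a component: inner vertices already have two neighbours, ends have no new
    ones, and for more than two vertices an edge between the ends would close a cycle. *)
Lemma path_component_ex (S : {set T}) x : x \in S ->
  (forall y z, y \in S -> e y z -> z \in S) ->
  exists p, [/\ p != [::], path_component p & {subset p <= S}].
Proof.
move=> xS closedS; have [h [t [up ep pS maxp]]] := maximal_path xS.
exists (h :: t); split=> //; split=> //.
set p := h :: t in up pS maxp *; set k := size p.
have nthS i : i.+1 < k -> e (nth h p i) (nth h p i.+1).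
  by move=> lti; apply: (pathP h ep i).
have nth_neq i j : i < k -> j < k -> i != j -> nth h p i != nth h p j.
  by move=> lti ltj; rewrite nth_uniq.
have inner i y : 0 < i -> i.+1 < k -> e (nth h p i) y ->
    y = nth h p i.-1 \/ y = nth h p i.+1.
  move=> i_gt0 lti iy.
  have e1 : e (nth h p i) (nth h p i.-1).
    by rewrite e_sym -{2}(prednK i_gt0) nthS // prednK // ltnW.
  have neq : nth h p i.-1 != nth h p i.+1.
    by apply: nth_neq => //; lia.
  by have /orP [/eqP|/eqP] := third_nbr deg2 e1 (nthS _ lti) neq iy; [left|right].
have in_p i y : i < k -> e (nth h p i) y -> y \in p.
  move=> lti iy; have yS : y \in S by apply: closedS iy; apply/pS/mem_nth.
  have [i0|i_gt0] := posnP i.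
    by apply: maxp; rewrite // -[h]/(nth h p 0) -i0 iy.
  have [lt|ge] := ltnP i.+1 k.
    by have [->|->] := inner i y i_gt0 lt iy; rewrite mem_nth //; lia.
  apply: maxp => //; rewrite (last_nth h) -/p.
  have -> : size t = i by have kE : k = (size t).+1 by []; lia.
  by rewrite iy orbT.
(* Edges join consecutive positions, except possibly one joining the two ends. *)
have adjP i j : i < k -> j < k -> e (nth h p i) (nth h p j) ->
    adjn i j \/ (i == 0) && (j == k.-1) || (j == 0) && (i == k.-1).
  move=> lti ltj ij.
  have idx a b : a < k -> b < k -> nth h p a = nth h p b -> a = b.
    by move=> lta ltb eq_ab; apply/eqP; rewrite -(nth_uniq h lta ltb up) eq_ab.
  have [/andP [i_gt0 lti']|ni] := boolP ((0 < i) && (i.+1 < k)).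
    by have [/idx|/idx] := inner i _ i_gt0 lti' ij; rewrite /adjn; lia.
  have [/andP [j_gt0 ltj']|nj] := boolP ((0 < j) && (j.+1 < k)).
    rewrite e_sym in ij.
    by have [/idx|/idx] := inner j _ j_gt0 ltj' ij; rewrite /adjn; lia.
  have neq : i != j by apply: contraTneq ij => ->; rewrite e_irr.
  by lia.
have no_closing : 2 < k -> ~~ e (nth h p 0) (nth h p k.-1).
  move=> k_gt2; apply/negP => closing.
  apply: (@no_cycle k (fun i => nth h p i)) => //.
    by move=> i j /eqP; rewrite nth_uniq // => /eqP/val_inj.
  move=> i j; rewrite cycle_relE //.
  have [lti ltj] := (ltn_ord i, ltn_ord j).
  apply/idP/idP => [|/adjP]; last first.
    by case=> //; [move=> ->|]; lia.
  case/or3P => [/orP [] /eqP E|/andP [/eqP -> /eqP E]|/andP [/eqP -> /eqP E]].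
  - by rewrite -E nthS ?E.
  - by rewrite e_sym -E nthS ?E.
  - by rewrite -E in closing.
  - by rewrite e_sym; rewrite -E in closing.
move=> x' y /(nthP h) [i lti <-].
apply/idP/andP => [iy|[/(nthP h) [j ltj <-]]]; last first.
  rewrite !index_uniq // /adjn => /orP [] /eqP E.
    by rewrite -E nthS ?E.
  by rewrite e_sym -E nthS ?E.
have yp := in_p _ _ lti iy; split=> //.
case/(nthP h): yp iy => j ltj <- ij; rewrite !index_uniq //.
have [//|H] := adjP _ _ lti ltj ij.
have [k_gt2|k_le2] := ltnP 2 k.
  case/orP: H ij => /andP [/eqP -> /eqP ->]; rewrite 1?e_sym.
    by rewrite e_sym; move/negPf: (no_closing k_gt2) => ->.
  by move/negPf: (no_closing k_gt2) => ->.
have neq : i != j by apply: contraTneq ij => ->; rewrite e_irr.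
by rewrite /adjn; lia.
Qed.

Lemma path_decomposition : exists ps : seq (seq T),
  [/\ forall p, p \in ps -> p != [::] /\ path_component p,
      uniq (flatten ps) & forall x, x \in flatten ps].
Proof.
suff [ps [psP ups psS]] : exists ps : seq (seq T),
    [/\ forall p, p \in ps -> p != [::] /\ path_component p,
      uniq (flatten ps) & flatten ps =i [set: T]].
  by exists ps; split=> // x; rewrite psS inE.
have : forall y z, y \in [set: T] -> e y z -> z \in [set: T] by [].
(* Induction on the size of a set closed under adjacency, removing one component at a time. *)
move: {2}#|_|.+1 (ltnSn #|[set: T]|) => k.
elim: k [set: T] => // k IHk S leS closedS.
have [->|[x xS]] := set_0Vmem S.
  by exists [::]; split=> // x; rewrite inE.
have [p [p0 pP pS]] := path_component_ex xS closedS.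
have [up eP] := pP.
have [||ps [psP ups psS]] := IHk (S :\: [set y in p]).
- rewrite -ltnS (leq_trans _ leS) // ltnS; apply: proper_card.
  apply/properP; split; first exact: subsetDl.
  case: p p0 pS {pP up eP} => // a p _ pS; exists a.
    by apply: pS; rewrite mem_head.
  by rewrite !inE eqxx.
- move=> y z; rewrite !inE => /andP [yp yS] yz; rewrite (closedS y) // andbT.
  by apply: contra yp => zp; move: yz; rewrite e_sym eP // => /andP [].
exists (p :: ps); split=> [q||y].
- by rewrite inE => /predU1P [->|/psP].
- rewrite /= cat_uniq up ups andbT; apply/hasPn => y /=.
  by rewrite psS !inE => /andP [].
rewrite /= mem_cat psS !inE; case: (boolP (y \in p)) => //= yp.
by rewrite pS.
Qed.

End PathDecomposition.

Lemma flatten_uniq_nth (ps : seq (seq T)) i j x : uniq (flatten ps) ->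
  x \in nth [::] ps i -> x \in nth [::] ps j -> i = j.
Proof.
elim: ps i j => [|p ps IHps] [|i] [|j] //=.
all: rewrite cat_uniq => /and3P [up disj ups].
- move=> xp xj; case/hasP: disj; exists x => //; apply/flattenP.
  exists (nth [::] ps j) => //; apply: mem_nth; rewrite ltnNge; apply/negP => ge.
  by rewrite nth_default in xj.
- move=> xj xp; case/hasP: disj; exists x => //; apply/flattenP.
  exists (nth [::] ps i) => //; apply: mem_nth; rewrite ltnNge; apply/negP => ge.
  by rewrite nth_default in xj.
by move=> xi xj; rewrite (IHps i j).
Qed.

Lemma path_components_iso (ps : seq (seq T)) (x0 : T) :
  (forall p, p \in ps -> path_component p) -> uniq (flatten ps) ->
  (forall x, x \in flatten ps) -> graph_iso (pf_rel (map size ps)) e.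
Proof.
move=> psP ups allps; set s := map size ps.
pose g (u : pf_vert s) := nth x0 (nth [::] ps (pf_comp u)) (pf_pos u).
have comp_lt (u : pf_vert s) : pf_comp u < size ps.
  by have := pf_comp_lt u; rewrite size_map.
have pos_lt (u : pf_vert s) : pf_pos u < size (nth [::] ps (pf_comp u)).
  by have := pf_pos_lt u; rewrite (nth_map [::]).
have gp u : g u \in nth [::] ps (pf_comp u) by apply: mem_nth.
have upP (u : pf_vert s) : uniq (nth [::] ps (pf_comp u)).
  by case: (psP _ (mem_nth [::] (comp_lt u))).
have g_inj : injective g.
  move=> u v eq_g; apply/eqP; rewrite pf_eqE.
  have eq_c : pf_comp u = pf_comp v.
    by apply: (flatten_uniq_nth ups (gp u)); rewrite eq_g.
  rewrite eq_c eqxx /= -(nth_uniq x0 _ _ (upP v)) // -?eq_c //.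
  by apply/eqP; rewrite {2}eq_c.
have g_surj x : exists u, g u = x.
  have /flattenP [p pps xp] := allps x.
  have [u [cu pu]] : exists u : pf_vert s,
      pf_comp u = index p ps /\ pf_pos u = index x p.
    apply: pf_ex; first by rewrite size_map index_mem.
    by rewrite (nth_map [::]) ?index_mem // nth_index // index_mem.
  by exists u; rewrite /g cu pu !nth_index.
exists g; split.
  apply: inj_card_bij => //; rewrite -(card_codom g_inj).
  apply: subset_leq_card; apply/subsetP => x _.
  by have [u <-] := g_surj x; apply: codom_f.
move=> u v; have [_ ->] := psP _ (mem_nth [::] (comp_lt u)); last exact: gp.
rewrite pf_relE; have [eq_c|neq_c] := eqVneq (pf_comp u) (pf_comp v).
  by rewrite {1}eq_c gp /g -eq_c !index_uniq // eq_c.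
apply/esym/negbTE; apply: contra neq_c => /andP [gv _].
by apply/eqP; apply: flatten_uniq_nth ups gv (gp v).
Qed.

End Decomposition.

(** * Assembling the classification *)

Lemma obs_cycle_family_iso n (T T' : finType) (e : rel T) (e' : rel T') :
  graph_iso e e' -> obs_cycle_family n e' -> obs_cycle_family n e.
Proof.
move=> iso_e.
have tr (T'' : finType) (e'' : rel T'') : graph_iso e' e'' -> graph_iso e e''.
  case: iso_e => f [f_bij fE] [g [g_bij gE]]; exists (g \o f); split.
    exact: bij_comp.
  by move=> x y; rewrite fE gE.
case=> [[m [m_ok /tr iso]]|]; first by left; exists m.
case=> [[m2 [m_ok /tr iso]]|]; first by right; left; exists m2.
case=> [[m2 [m4 [m_ok /tr iso]]]|]; first by right; right; left; exists m2, m4.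
case=> [[m2 [m4 [m6 [m_ok /tr iso]]]]|].
  by right; right; right; left; exists m2, m4, m6.
case=> [[n_ok /tr iso]|]; first by do 4 right; left.
case=> [[n_ok /tr iso]|[n_ok /tr iso]]; first by do 5 right; left.
by do 6 right.
Qed.

Lemma minimal_obs_cycle_family n (T : finType) (e : rel T) : 4 < n ->
  symmetric e -> irreflexive e -> minimal_obstruction e (cycle_rel n) ->
  obs_cycle_family n e.
Proof.
move=> n_gt4 e_sym e_irr min_e.
have [|/existsPn no_tri] := boolP [exists a, exists b, exists c,
    [&& e a b, e b c & e a c]].
  case/existsP => a /existsP [b /existsP [c /and3P [ab bc ac]]].
  exact: triangle_family min_e _ _ _ ab bc ac.
have tri a b c : e a b -> e b c -> e a c -> False.
  move=> ab bc ac; case/negP: (no_tri a); apply/existsP; exists b.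
  by apply/existsP; exists c; rewrite ab bc.
have [|/existsPn no_sq] := boolP [exists a, exists b, exists c, exists d,
    [&& a != c, b != d, e a b, e b c, e c d & e d a]].
  case/existsP => a /existsP [b /existsP [c /existsP [d]]].
  case/and5P => ac bd ab bc /andP [cd da].
  exact: square_family tri _ _ _ _ ac bd ab bc cd da.
have sq a b c d : a != c -> b != d -> e a b -> e b c -> e c d -> e d a -> False.
  move=> ac bd ab bc cd da; case/negP: (no_sq a); apply/existsP; exists b.
  by apply/existsP; exists c; apply/existsP; exists d; rewrite ac bd ab bc cd.
have [|/existsPn no_3] := boolP [exists v, exists a, exists b, exists c,
    [&& a != b, a != c, b != c, e v a, e v b & e v c]].
  case/existsP => v /existsP [a /existsP [b /existsP [c]]].
  case/and5P => ab ac bc va /andP [vb vc].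
  exact: degree3_family tri sq _ _ _ _ va vb vc ab ac bc.
have deg2 v a b c :
    e v a -> e v b -> e v c -> a != b -> a != c -> b != c -> False.
  move=> va vb vc ab ac bc; case/negP: (no_3 v); apply/existsP; exists a.
  by apply/existsP; exists b; apply/existsP; exists c; rewrite ab ac bc va vb.
(* Bounding the length by [#|T|] and taking [g] as a finite function makes the existence of a cycle
   decidable. *)
have [|/existsPn no_cyc] := boolP [exists m : 'I_#|T|.+1,
    exists g : {ffun 'I_m -> T}, [&& 2 < m, injectiveb g &
      [forall i, forall j, cycle_rel m i j == e (g i) (g j)]]].
  case/existsP => m /existsP [g /and3P [m_gt2 /injectiveP g_inj /forallP gE]].
  apply: (@cycle_component_family _ _ e_sym e_irr deg2 m g) => // i j.
  by apply/eqP; move/forallP: (gE i).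
have cyc m (g : 'I_m -> T) : 2 < m -> injective g ->
    (forall i j, cycle_rel m i j = e (g i) (g j)) -> False.
  move=> m_gt2 g_inj gE.
  have lt_m : m < #|T|.+1.
    by have := max_card (mem (codom g)); rewrite card_codom ?card_ord.
  case/negP: (no_cyc (Ordinal lt_m)); apply/existsP; exists [ffun i => g i].
  apply/and3P; split=> //.
    by apply/injectiveP => i j; rewrite !ffunE => /g_inj.
  by apply/forallP => i; apply/forallP => j; rewrite !ffunE gE.
(* The empty graph is colourable, so [T] is inhabited; [x0] serves as a default value. *)
have [x0] : exists x0 : T, true.
  apply/existsP; apply: contraT => /existsPn noT.
  case: min_e => ncol _; case: ncol.
  have n_gt0 : 0 < n by apply: leq_trans n_gt4.
  by exists (fun=> Ordinal n_gt0) => x; have := noT x.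
move=> _; have [ps [psP ups allps]] := path_decomposition e_sym e_irr deg2 cyc.
(* Sorting by length puts a [K_1] first and equal orders together. *)
pose qs := sort (relpre size leq) ps.
have perm_qs : perm_eq qs ps by rewrite perm_sort.
have qsP p : p \in qs -> p != [::] /\ path_component e p.
  by rewrite (perm_mem perm_qs); apply: psP.
have iso_qs : graph_iso (pf_rel (map size qs)) e.
  apply: (path_components_iso x0) => [p /qsP [] //||x].
    by rewrite (perm_uniq (perm_flatten perm_qs)).
  by rewrite (perm_mem (perm_flatten perm_qs)).
apply: (obs_cycle_family_iso (graph_iso_sym iso_qs)).
apply: pf_minimal_family => //.
- apply/allP => k /mapP [p /qsP [p0 _] ->]; by case: p p0.
- by rewrite sorted_map sort_sorted // => p q; apply: leq_total.
exact: minimal_iso iso_qs min_e.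
Qed.

Theorem theorem3p10 (n : nat) : 5 <= n ->
  forall (T : finType) (e : rel T), symmetric e -> irreflexive e ->
  (minimal_obstruction e (cycle_rel n) <-> obs_cycle_family n e).
Proof.
move=> n_gt4 T e e_sym e_irr; split; first exact: minimal_obs_cycle_family.
case=> [[m [m_ok iso]]|].
  by apply: minimal_iso iso _; apply: cycle_minimal; lia.
case=> [[m2 [m_ok iso]]|]; first by apply: minimal_iso iso _; apply: pf_K2_minimal.
case=> [[m2 [m4 [m_ok iso]]]|].
  (* The [K_1] contributes 2 and the other paths [n], so the excess is 2. *)
  apply: minimal_iso iso _; apply: (pf_K1_minimal (d := 2)) => // [k||].
  - by rewrite mem_cat !mem_nseq !inE => /orP [] /andP [_ ->]; rewrite ?orbT.
  - by rewrite mem_cat !mem_nseq !andbF.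
  - by rewrite /= sumn_cat size_cat !sumn_nseq !size_nseq; lia.
case=> [[m2 [m4 [m6 [m_ok iso]]]]|].
  (* The other paths now contribute [n - 1], so the excess is 1 and a [P_6] is allowed. *)
  apply: minimal_iso iso _; apply: (pf_K1_minimal (d := 1)) => // [k||].
  - by rewrite !mem_cat !mem_nseq !inE => /or3P [] /andP [_ ->]; rewrite ?orbT.
  - by case: (6 \in _).
  - by rewrite /= !sumn_cat !size_cat !sumn_nseq !size_nseq; lia.
case=> [[n_ok iso]|]; first by apply: minimal_iso iso _; apply: graph_B_minimal.
case=> [[n_ok iso]|[n_ok iso]]; apply: minimal_iso iso _.
  exact: graph_A_minimal.
exact: graph_E_minimal.
Qed.
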